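(* Let $C=(c_{ij})_{i,j\ge1}$ be an infinite matrix with entries in $\mathbb{Z}_2=\{0,1\}$ satisfying $c_{ij}=c_{ji}$ and $c_{ii}=0$ for all $i,j$, and let $\omega:\Gamma\times\Gamma\to\mathbb{Z}_2$ be the form $$\omega(x,y)=\sum_{i,j=1}^\infty c_{ij}x_jy_i,\qquad x,y\in\Gamma.$$ Assume that $C$ has infinite rank, i.e. $\Gamma/\ker\omega$ is infinite dimensional. Let $\bar U=(U_1,U_2,\dots)$ be any irreducible spin system satisfying the commutation relations $$U_iU_j=(-1)^{c_{ij}}U_jU_i,\qquad i,j=1,2,\dots.$$ Then every irreducible spin system satisfying the same commutation relations is equivalent to $\bar U^\gamma$ for some $\gamma\in\mathbb{Z}_2^\infty$. Given two sequences $\gamma,\gamma'\in\mathbb{Z}_2^\infty$, the spin systems $\bar U^\gamma$ and $\bar U^{\gamma'}$ are equivalent if and only if $\gamma$ and $\gamma'$ define the same linear functional on $\ker\omega$: $$\sum_{k=1}^\infty\gamma_kx_k=\sum_{k=1}^\infty\gamma'_kx_k\ \text{ in }\mathbb{Z}_2,\qquad x\in\ker\omega.$$ In particular, if $\ker\omega$ is of finite dimension $d$ as a vector space over $\mathbb{Z}_2$, then there are exactly $2^d$ equivalence classes of irreducible spin systems associated with $C$. If $\ker\omega$ is infinite dimensional, then the set of distinct equivalence classes of irreducible spin systems associated with $C$ has the cardinality of the continuum $2^{\aleph_0}$.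
   Context: $\mathbb{Z}_2=\{0,1\}$ is the two-element field; $\Gamma$ is the $\mathbb{Z}_2$-vector space of sequences $x=(x_1,x_2,\dots)$ in $\mathbb{Z}_2$ with only finitely many nonzero terms; $\mathbb{Z}_2^\infty$ is the space of all sequences in $\mathbb{Z}_2$; $\ker\omega=\{x\in\Gamma:\omega(x,\Gamma)=\{0\}\}$. A spin system associated with $C$ is a sequence of self-adjoint unitary operators $U_1,U_2,\dots$ on a Hilbert space $H\neq\{0\}$ with $U_iU_j=(-1)^{c_{ij}}U_jU_i$ for all $i,j$; it is irreducible if $\{U_1,U_2,\dots\}$ is an irreducible set of operators (commutant equal to the scalars). Under the infinite rank assumption irreducible spin systems act on infinite dimensional Hilbert spaces. Two spin systems $\bar U$ on $H$ and $\bar V$ on $K$ are equivalent (approximately unitarily equivalent) if there is a sequence of unitary operators $W_1,W_2,\dots:H\to K$ with $\lim_{n\to\infty}\|W_nU_kW_n^{-1}-V_k\|=0$ for every $k=1,2,\dots$. For $\gamma=(\gamma_1,\gamma_2,\dots)\in\mathbb{Z}_2^\infty$, $\bar U^\gamma=((-1)^{\gamma_1}U_1,(-1)^{\gamma_2}U_2,\dots)$, which is again an irreducible spin system satisfying the same commutation relations. *)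

(* Defs.v *)
From HB Require Import structures.
From mathcomp Require Import all_boot all_order all_algebra.
From mathcomp Require Import complex.
From mathcomp Require Import all_classical all_reals.
From mathcomp Require Import ereal topology normedtype sequences.

Set Implicit Arguments.
Unset Strict Implicit.
Unset Printing Implicit Defensive.

Import Order.TTheory GRing.Theory Num.Theory.
Import numFieldNormedType.Exports.

Local Open Scope classical_set_scope.
Local Open Scope ring_scope.

(* [inner] is linear in its first argument and conjugate-linear in its second.
   The norm of a normed module over [R[i]] takes values in [R[i]]. *)
HB.mixin Record CompleteNormedModule_isHilbert (R : realType) H
    & CompleteNormedModule R[i] H := {
  inner : {dot H for @Num.conj R[i]} ;
  inner_normE : forall x : H, inner x x = `|x| ^+ 2
}.

#[short(type="hilbertType")]
HB.structure Definition Hilbert (R : realType) :=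
  {H of CompleteNormedModule R[i] H & CompleteNormedModule_isHilbert R H}.

Section Operators.
Context {R : realType}.

Definition bounded_operator {H K : hilbertType R} : set (H -> K) :=
  [set T | linear T /\ continuous T].

Definition adjoint (H K : hilbertType R) (T : H -> K) (T' : K -> H) : Prop :=
  forall x y, inner (T x) y = inner x (T' y).

Definition self_adjoint (H : hilbertType R) (T : H -> H) : Prop := adjoint T T.

Definition unitary (H K : hilbertType R) (W : H -> K) : Prop :=
  bounded_operator W /\
  exists W' : K -> H,
    [/\ bounded_operator W', adjoint W W', cancel W W' & cancel W' W].

Definition opnorm (H K : hilbertType R) (T : H -> K) : \bar R :=
  ereal_sup [set (complex.Re `|T x|)%:E | x in [set x : H | `|x| <= 1]].

Definition commutant (H : hilbertType R) (S : set (H -> H)) : set (H -> H) :=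
  bounded_operator `&` [set T : H -> H | forall A, S A -> T \o A = A \o T].

Definition irreducible_set (H : hilbertType R) (S : set (H -> H)) : Prop :=
  commutant S = range (fun (a : R[i]) (x : H) => a *: x).

End Operators.

(* Sequences are indexed from 0 instead of 1. [Z2infty] is the space of all
   sequences as a vector space over the field ['F_2]; the regular
   module ['F_2^o] provides the scalar action. *)
Definition Z2infty : lmodType 'F_2 := nat -> ('F_2)^o.

Definition Gamma : set Z2infty :=
  [set x | finite_set [set i | x i != 0]].

(* [\sum_(_ \in _)] is the sum of a finitely supported family; the support is
   finite when [x] and [y] are in [Gamma]. *)
Definition omega (c : nat -> nat -> 'F_2) (x y : Z2infty) : 'F_2 :=
  \sum_(p \in [set: nat * nat]) c p.1 p.2 * x p.2 * y p.1.

Definition ker_omega (c : nat -> nat -> 'F_2) : set Z2infty :=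
  [set x | Gamma x /\ forall y, Gamma y -> omega c x y = 0].

Definition pairing (gamma x : Z2infty) : 'F_2 :=
  \sum_(k \in [set: nat]) gamma k * x k.

(* For subspaces [N `<=` W] of [V]: the classes of the [b i] form a basis of
   the quotient space [W / N]. *)
Definition quotient_basis (F : fieldType) (V : lmodType F) (W N : set V)
    (d : nat) (b : 'I_d -> V) : Prop :=
  (forall i, W (b i)) /\
  forall x, W x -> exists! a : {ffun 'I_d -> F}, N (x - \sum_i a i *: b i).

Definition quotient_dim (F : fieldType) (V : lmodType F) (W N : set V)
    (d : nat) : Prop :=
  exists b : 'I_d -> V, quotient_basis W N b.

Definition infinite_quotient_dim (F : fieldType) (V : lmodType F)
    (W N : set V) : Prop :=
  forall d, ~ quotient_dim W N d.

Definition has_dim (F : fieldType) (V : lmodType F) (W : set V) (d : nat) :=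
  quotient_dim W [set 0] d.

Definition infinite_dim (F : fieldType) (V : lmodType F) (W : set V) :=
  infinite_quotient_dim W [set 0].

Definition infinite_rank (c : nat -> nat -> 'F_2) : Prop :=
  infinite_quotient_dim Gamma (ker_omega c).

Section SpinSystems.
Context {R : realType}.

Definition sign2 (a : 'F_2) : R[i] := (-1) ^+ (a : nat).

Definition spin_system (c : nat -> nat -> 'F_2) (H : hilbertType R)
    (U : nat -> H -> H) : Prop :=
  [/\ exists x : H, x != 0,
      forall k, self_adjoint (U k),
      forall k, unitary (U k) &
      forall i j x, U i (U j x) = sign2 (c i j) *: U j (U i x)].

Definition irreducible_spin_system (c : nat -> nat -> 'F_2)
    (H : hilbertType R) (U : nat -> H -> H) : Prop :=
  spin_system c U /\ irreducible_set (range U).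

(* Approximate unitary equivalence; [W' n] is the inverse of [W n]. *)
Definition spin_equiv (H K : hilbertType R) (U : nat -> H -> H)
    (V : nat -> K -> K) : Prop :=
  exists (W : nat -> H -> K) (W' : nat -> K -> H),
    (forall n, [/\ unitary (W n), cancel (W n) (W' n) & cancel (W' n) (W n)]) /\
    forall k,
      (fun n => opnorm (fun y : K => W n (U k (W' n y)) - V k y)) @ \oo
        --> (0%E : \bar R).

Definition twist (H : hilbertType R) (gamma : Z2infty)
    (U : nat -> H -> H) : nat -> H -> H :=
  fun k x => sign2 (gamma k) *: U k x.

End SpinSystems.

(* An irreducible spin system bundled with the space it acts on. *)
Record irrSpinSystem (R : realType) (c : nat -> nat -> 'F_2) := IrrSpinSystem {
  spin_space : hilbertType R ;
  spin_op : nat -> spin_space -> spin_space ;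
  spin_opP : irreducible_spin_system c spin_op
}.

(* Plain predicates instead of [set]s: [irrSpinSystem] lives in a universe above
   the one that [set] and [#=] accept. *)
Definition spin_class (R : realType) (c : nat -> nat -> 'F_2)
    (S : irrSpinSystem R c) : irrSpinSystem R c -> Prop :=
  fun T => spin_equiv (@spin_op _ _ S) (@spin_op _ _ T).

Definition is_spin_class (R : realType) (c : nat -> nat -> 'F_2)
    (A : irrSpinSystem R c -> Prop) : Prop :=
  exists S, A = spin_class S.

(* The set of equivalence classes is in bijection with the type [I]. *)
Definition spin_classes_card (R : realType) (c : nat -> nat -> 'F_2)
    (I : Type) : Prop :=
  exists f : I -> (irrSpinSystem R c -> Prop),
    (forall i j, f i = f j -> i = j) /\
    (forall A, is_spin_class A <-> exists i, f i = A).

(* Main.v *)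
Require Import Defs.
From HB Require Import structures.
From mathcomp Require Import all_boot all_order all_algebra.
From mathcomp Require Import complex.
From mathcomp Require Import all_classical all_reals.
From mathcomp Require Import ereal topology normedtype sequences.
From mathcomp Require Import ring.

(* A finite word in the generators stands for an element of Gamma. Words in the
   radical of omega commute with all the generators, so in an irreducible system
   they act as scalars, and these scalars decide the equivalence class. By
   infinite rank, Gamma is the radical plus the span of an infinite symplectic
   sequence (p_i, q_i); with suitable phases its words act as self-adjoint
   unitaries P_i, Q_i which anticommute within each pair and commute otherwise.
   For each n the common fixed space of P_0, ..., P_(n-1) is separable, as an
   irreducible system is cyclic, and infinite dimensional, because of the pairs
   of index at least n. An orthonormal basis of it, moved around by the Q_i,
   becomes a basis of the whole space on which P_i and Q_i, i < n, act by
   universal signs and permutations. Matching two such bases gives a unitary that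
   intertwines two systems with the same scalars exactly on finitely many
   generators. Conversely, the scalars survive limits of unitary conjugates. The
   scalars of two systems differ by a character of the radical, and a functional
   on the radical extends to a unique gamma supported on the pivots, that is, the
   positions of the last nonzero coordinates of its elements: this gives the
   twisting by gamma, and the count. An irreducible system exists on l^2(N), where
   P_i and Q_i read and flip the i-th binary digit of the index. *)

Set Implicit Arguments.
Unset Strict Implicit.
Unset Printing Implicit Defensive.

Import Order.TTheory GRing.Theory Num.Theory.
Import numFieldNormedType.Exports.

Local Open Scope classical_set_scope.
Local Open Scope ring_scope.

(** * Hilbert spaces and orthonormal systems *)

(** Nothing is assumed on the size of the Hilbert spaces. Two systems can be matched because in each
    of them the fixed subspace has a basis indexed by [nat] with no zero vector, whatever the
    system. The intertwiners for different [n] come from unrelated choices of bases, so they yield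
    no single unitary for all generators; approximate equivalence asks for none. Generators are
    related to the pairs by reduction: removing the components of a generator along the first [m]
    pairs must leave a radical word, which is a scalar. The sequence of pairs is therefore built so
    that every generator is exhausted at some finite stage. Words replace vectors of [Gamma] because
    a product of generators depends on their order. Two words of the same vector differ by a sign
    computed from [c] alone, which cancels when two systems are compared. The square of a radical
    scalar is also a sign computed from [c], which is why two systems differ by a character with
    values in signs. For existence, each generator is replaced by a word in the model pairs having
    its symplectic coordinates; this preserves the commutation relations, and radical words become
    scalars. *)

Section DotProduct.
Variables (C : numClosedFieldType) (U : lmodType C).
Variable form : {dot U for Num.conj}.

Lemma dot_cauchy_schwarz (x y : U) :
  `|form x y| ^+ 2 <= form x x * form y y.
Proof.
have [->|y0] := eqVneq y 0; first by rewrite !linear0r normr0 expr0n mulr0.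
have yy0 : 0 < form y y by rewrite dnorm_gt0.
rewrite -ler_pdivrMr // -subr_ge0.
pose b := form x y / form y y.
suff -> : form x x - `|form x y| ^+ 2 / form y y
          = form (x - b *: y) (x - b *: y) by [].
have yyR : (form y y)^* = form y y by rewrite geC0_conj // ltW.
have yxC : form y x = (form x y)^* by rewrite hermC mul1r.
rewrite linearBl !linearBr !linearZl_LR !linearZr_LR /= normCK /b.
rewrite rmorphM fmorphV /= yyR yxC; set t := form x y; set u := form y y.
have u0 : u != 0 by rewrite lt0r_neq0.
(* The identity holds with [t^*] as an independent indeterminate, which lets [field] conclude. *)
by move: (t^*) u0 => s u0; field.
Qed.

(** Stated for a bare form, as [l2] needs it before it carries a norm. *)
Lemma dot_triangle (x y : U) :
  sqrtC (form (x + y) (x + y)) <= sqrtC (form x x) + sqrtC (form y y).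
Proof.
rewrite -(@ler_pXn2r _ 2) ?nnegrE ?addr_ge0 ?sqrtC_ge0 //.
rewrite sqrrD !sqrtCK dnormD addrAC lerD2r lerD2l.
have h : form x y + (form x y)^* <= `|form x y| *+ 2.
  have := (leif_Re_Creal (form x y)).1; rewrite ReE.
  by rewrite ler_pdivrMr ?ltr0n // mulr_natr.
apply: (le_trans h); rewrite lerMn2r /= -sqrtCM ?nnegrE //.
rewrite -(@ler_pXn2r _ 2) ?nnegrE ?sqrtC_ge0 ?mulr_ge0 // sqrtCK.
exact: dot_cauchy_schwarz.
Qed.

End DotProduct.

Section InnerProduct.
Context {R : realType} {H : hilbertType R}.
Implicit Types (x y z : H) (a : R[i]).

Lemma innerDl x y z : inner (x + y) z = inner x z + inner y z.
Proof. by rewrite linearDl. Qed.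

Lemma innerDr x y z : inner x (y + z) = inner x y + inner x z.
Proof. by rewrite linearD. Qed.

Lemma innerZl a x y : inner (a *: x) y = a * inner x y.
Proof. by rewrite linearZl_LR. Qed.

Lemma innerZr a x y : inner x (a *: y) = a^* * inner x y.
Proof. by rewrite linearZr_LR. Qed.

Lemma inner0l y : inner (0 : H) y = 0.
Proof. by rewrite linear0l. Qed.

Lemma inner0r x : inner x (0 : H) = 0.
Proof. by rewrite linear0r. Qed.

Lemma innerNl x y : inner (- x) y = - inner x y.
Proof. by rewrite linearNl. Qed.

Lemma innerNr x y : inner x (- y) = - inner x y.
Proof. by rewrite linearNr. Qed.

Lemma innerBl x y z : inner (x - y) z = inner x z - inner y z.
Proof. by rewrite innerDl innerNl. Qed.

Lemma innerBr x y z : inner x (y - z) = inner x y - inner x z.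
Proof. by rewrite innerDr innerNr. Qed.

Lemma inner_suml (I : Type) (r : seq I) (P : pred I) (F : I -> H) y :
  inner (\sum_(i <- r | P i) F i) y = \sum_(i <- r | P i) inner (F i) y.
Proof.
exact: (big_morph (inner^~ y) (fun u v => innerDl u v y) (inner0l y)).
Qed.

Lemma inner_sumr (I : Type) (r : seq I) (P : pred I) (F : I -> H) x :
  inner x (\sum_(i <- r | P i) F i) = \sum_(i <- r | P i) inner x (F i).
Proof. exact: (big_morph (inner x) (innerDr x) (inner0r x)). Qed.

Lemma innerC x y : inner x y = (inner y x)^*.
Proof. by rewrite hermC mul1r. Qed.

Lemma inner_eq0C x y : inner x y = 0 -> inner y x = 0.
Proof. by rewrite innerC => /eqP; rewrite fmorph_eq0 => /eqP. Qed.

Lemma inner_self_eq0 x : inner x x = 0 -> x = 0.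
Proof. by rewrite inner_normE => /eqP; rewrite sqrf_eq0 normr_eq0 => /eqP. Qed.

Lemma inner_inj x y : (forall z, inner x z = inner y z) -> x = y.
Proof.
move=> xy; apply/eqP; rewrite -subr_eq0; apply/eqP/inner_self_eq0.
by rewrite innerBl xy subrr.
Qed.

Lemma cauchy_schwarz x y : `|inner x y| <= `|x| * `|y|.
Proof.
rewrite -(@ler_pXn2r _ 2) ?nnegrE ?mulr_ge0 // exprMn -!inner_normE.
exact: dot_cauchy_schwarz.
Qed.

End InnerProduct.

Section LinearMaps.
Context {R : realType} {H K : hilbertType R}.
Variable T : H -> K.
Hypothesis lT : linear T.

Lemma linmapD x y : T (x + y) = T x + T y.
Proof. by have := lT 1 x y; rewrite !scale1r. Qed.

Lemma linmap0 : T 0 = 0.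
Proof. by apply: (addrI (T 0)); rewrite -linmapD !addr0. Qed.

Lemma linmapZ (a : R[i]) x : T (a *: x) = a *: T x.
Proof. by rewrite -[a *: x]addr0 lT linmap0 addr0. Qed.

Lemma linmapN x : T (- x) = - T x.
Proof. by rewrite -scaleN1r linmapZ scaleN1r. Qed.

Lemma linmapB x y : T (x - y) = T x - T y.
Proof. by rewrite linmapD linmapN. Qed.

End LinearMaps.

Section OrthonormalSystems.
Context {R : realType}.
Local Notation C := R[i].

Definition orthosys (H : hilbertType R) (e : nat -> H) : Prop :=
  (forall i j, i != j -> inner (e i) (e j) = 0) /\
  (forall i, inner (e i) (e i) = (e i != 0)%:R).

(** Density of the span, expressed through its orthogonal complement so that no closure appears. *)
Definition total_seq (H : hilbertType R) (t : nat -> H) : Prop :=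
  forall x, (forall i, inner x (t i) = 0) -> x = 0.

Lemma orthosys_pythagoras (H : hilbertType R) (e : nat -> H) (c : nat -> C) m n :
  orthosys e ->
  `|\sum_(m <= i < n) c i *: e i| ^+ 2
    = \sum_(m <= i < n) `|c i| ^+ 2 * (e i != 0)%:R.
Proof.
move=> [eo en]; rewrite -inner_normE inner_suml.
apply: eq_big_nat => i /andP[mi ni].
rewrite inner_sumr (bigD1_seq i) ?iota_uniq //=; last first.
  by rewrite mem_index_iota mi ni.
rewrite big1 => [|j ji]; first by rewrite addr0 innerZl innerZr en mulrA normCK.
by rewrite innerZl innerZr eo 1?eq_sym // !mulr0.
Qed.

Lemma orthosys_bessel (H : hilbertType R) (e : nat -> H) (x : H) n :
  orthosys e ->
  \sum_(0 <= i < n) `|inner x (e i)| ^+ 2 <= `|x| ^+ 2.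
Proof.
move=> oe; pose y := \sum_(0 <= i < n) inner x (e i) *: e i.
have zE i : `|inner x (e i)| ^+ 2 * (e i != 0)%:R = `|inner x (e i)| ^+ 2.
  have [->|_] := eqVneq (e i) 0; last by rewrite mulr1.
  by rewrite inner0r normr0 expr0n mul0r.
have yy : inner y y = \sum_(0 <= i < n) `|inner x (e i)| ^+ 2.
  by rewrite inner_normE orthosys_pythagoras //; apply: eq_bigr.
have xy : inner x y = \sum_(0 <= i < n) `|inner x (e i)| ^+ 2.
  by rewrite inner_sumr; apply: eq_bigr => i _; rewrite innerZr normCK mulrC.
rewrite -subr_ge0 -inner_normE.
suff <- : inner (x - y) (x - y)
    = inner x x - \sum_(0 <= i < n) `|inner x (e i)| ^+ 2.
  by rewrite inner_normE exprn_ge0.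
have yx : inner y x = inner x y.
  by rewrite innerC xy rmorph_sum; apply: eq_bigr => i _; rewrite rmorphXn /= conj_normC.
by rewrite innerBl !innerBr yx yy xy subrr subr0.
Qed.

Lemma orthosys_series_cvg (H : hilbertType R) (e : nat -> H) (c : nat -> C) B :
  orthosys e -> (forall n, \sum_(0 <= i < n) `|c i| ^+ 2 <= B) ->
  cvgn (series (fun i => c i *: e i)).
Proof.
move=> oe cB.
(* Norms take values in [R[i]]; monotone convergence is applied to the real series of the [a i]. *)
pose a i : R := complex.Re (`|c i| ^+ 2).
have aE i : (a i)%:C%C = `|c i| ^+ 2.
  by rewrite /a RRe_real // ger0_real // exprn_ge0.
have a0 i : 0 <= a i by rewrite -ler0c aE exprn_ge0.
have aS m n : (\sum_(m <= i < n) a i)%:C%C = \sum_(m <= i < n) `|c i| ^+ 2.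
  by rewrite rmorph_sum; apply: eq_bigr => i _; exact: aE.
have : cvgn (series a).
  apply: nondecreasing_is_cvgn; first by apply: nondecreasing_series => n _ _.
  exists (complex.Re B) => _ [n _ <-].
  by have := cB n; rewrite -aS lecE /= => /andP[].
move=> /cauchy_cvgP/cauchy_seriesP a_cauchy.
apply/cauchy_cvgP/cauchy_seriesP => r r0.
have rR : (complex.Re r)%:C%C = r by rewrite RRe_real // gtr0_real.
have r0' : 0 < complex.Re r ^+ 2 by rewrite exprn_gt0 // -ltcR rR.
have := a_cauchy _ r0'; apply: filterS => -[m n] /= amn.
rewrite -(@ltr_pXn2r _ 2) ?nnegrE // 1?ltW // orthosys_pythagoras //.
apply: (@le_lt_trans _ _ (\sum_(m <= i < n) a i)%:C%C).
  rewrite aS; apply: ler_sum => i _.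
  by rewrite ler_piMr ?exprn_ge0 //; case: (_ != _).
rewrite -rR -rmorphXn ltcR; apply: le_lt_trans amn.
by rewrite ler_norm.
Qed.

(** The partial isometry carrying the nonzero [e i] to [f i]; for [f = e] it is the orthogonal
    projection onto the closed span of [e]. *)
Definition osum (H K : hilbertType R) (e : nat -> H) (f : nat -> K) (x : H) : K :=
  limn (series (fun i => inner x (e i) *: f i)).

Lemma osum_cvg (H K : hilbertType R) (e : nat -> H) (f : nat -> K) (x : H) :
  orthosys e -> orthosys f ->
  series (fun i => inner x (e i) *: f i) @ \oo --> osum e f x.
Proof.
move=> oe of_; apply: (orthosys_series_cvg (B := `|x| ^+ 2) of_) => n.
exact: orthosys_bessel.
Qed.

Lemma inner_cvg_eq (H K : hilbertType R) (s : nat -> H) (t : nat -> K) a b x y :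
  s @ \oo --> a -> t @ \oo --> b ->
  (forall n, inner (s n) y = inner x (t n)) -> inner a y = inner x b.
Proof.
move=> sa tb st; apply/eqP; rewrite -subr_eq0 -normr_eq0.
suff h : forall r : C, 0 < r -> `|inner a y - inner x b| < r.
  rewrite eq_le normr_ge0 andbT; apply/contraT => /negP nle.
  have : 0 < `|inner a y - inner x b|.
    by rewrite lt_def normr_ge0 andbT; apply/eqP => h0; apply: nle; rewrite h0.
  by move/h; rewrite ltxx.
move=> r r0.
(* The summand 1 keeps [M] positive when [x] and [y] vanish. *)
pose M := `|x| + `|y| + 1.
have M0 : 0 < M by rewrite ltr_wpDl // addr_ge0.
have rM : 0 < r / M by rewrite divr_gt0.
have [n [sn tn]] : exists n, `|a - s n| < r / M /\ `|b - t n| < r / M.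
  have [N1 _ h1] := (@cvgrPdist_lt _ _ _ _ _ _ _).1 sa _ rM.
  have [N2 _ h2] := (@cvgrPdist_lt _ _ _ _ _ _ _).1 tb _ rM.
  exists (maxn N1 N2); split; [apply: h1|apply: h2] => /=.
    by rewrite leq_maxl.
  by rewrite leq_maxr.
have -> : inner a y - inner x b = inner (a - s n) y - inner x (b - t n).
  by rewrite innerBl innerBr st opprB addrA subrK.
apply: (le_lt_trans (ler_normB _ _)).
apply: (@le_lt_trans _ _ (r / M * (`|y| + `|x|))).
  rewrite mulrDr lerD //; apply: (le_trans (cauchy_schwarz _ _)).
    by rewrite ler_wpM2r // ltW.
  by rewrite mulrC ler_wpM2r // ltW.
by rewrite -mulrA gtr_pMr // mulrC ltr_pdivrMr // mul1r /M [`|y| + _]addrC ltrDl.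
Qed.

End OrthonormalSystems.

Section Osum.
Context {R : realType}.
Local Notation C := R[i].

Lemma osum_adjoint (H K : hilbertType R) (e : nat -> H) (f : nat -> K) x y :
  orthosys e -> orthosys f -> inner (osum e f x) y = inner x (osum f e y).
Proof.
move=> oe of_; have cx := osum_cvg (x := x) oe of_; have cy := osum_cvg (x := y) of_ oe.
apply: (inner_cvg_eq cx cy) => n.
rewrite inner_suml inner_sumr; apply: eq_bigr => i _.
by rewrite innerZl innerZr -innerC mulrC.
Qed.

(** A map with an adjoint is linear, so limits need not be added. *)
Lemma osum_linear (H K : hilbertType R) (e : nat -> H) (f : nat -> K) :
  orthosys e -> orthosys f -> linear (osum e f).
Proof.
move=> oe of_ a x y; apply: inner_inj => z.
by rewrite innerDl innerZl !osum_adjoint // innerDl innerZl.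
Qed.

Lemma osum_eq (H K : hilbertType R) (e : nat -> H) (f : nat -> K) x y :
  (forall i, inner x (e i) *: f i = inner y (e i) *: f i) ->
  osum e f x = osum e f y.
Proof. by move=> xy; rewrite /osum (funext xy). Qed.

Lemma osum_basis (H K : hilbertType R) (e : nat -> H) (f : nat -> K) i :
  orthosys e -> osum e f (e i) = (e i != 0)%:R *: f i.
Proof.
move=> [eo en]; apply: cvg_lim; first exact: norm_hausdorff.
apply/cvgrPdist_lt => r r0; exists i.+1 => // n /= lt_in.
rewrite (_ : series _ n = (e i != 0)%:R *: f i) ?subrr ?normr0 //.
rewrite /series /= (bigD1_seq i) ?iota_uniq ?mem_index_iota //= en.
by rewrite big1 ?addr0 // => j ji; rewrite eo 1?eq_sym // scale0r.
Qed.

Lemma osum_inner (H K : hilbertType R) (e : nat -> H) (f : nat -> K) x i :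
  orthosys e -> orthosys f ->
  inner (osum e f x) (f i) = (f i != 0)%:R * inner x (e i).
Proof.
by move=> oe of_; rewrite osum_adjoint // osum_basis // innerZr rmorph_nat.
Qed.

Lemma osum_idem (H : hilbertType R) (e : nat -> H) x :
  orthosys e -> osum e e (osum e e x) = osum e e x.
Proof.
move=> oe; apply: osum_eq => i; rewrite osum_inner //.
by have [->|_] := eqVneq (e i) 0; rewrite ?scaler0 // mul1r.
Qed.

Lemma osum_proj_orth (H : hilbertType R) (e : nat -> H) x i :
  orthosys e -> inner (x - osum e e x) (e i) = 0.
Proof.
move=> oe; rewrite innerBl osum_inner //.
have [->|_] := eqVneq (e i) 0; last by rewrite mul1r subrr.
by rewrite inner0r mulr0 subr0.
Qed.

Lemma osum_total (H : hilbertType R) (e : nat -> H) x :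
  orthosys e -> total_seq e -> osum e e x = x.
Proof.
move=> oe te; apply/eqP; rewrite eq_sym -subr_eq0; apply/eqP/te => i.
exact: osum_proj_orth.
Qed.

Lemma contraction_bounded (H K : hilbertType R) (T : H -> K) :
  linear T -> (forall x, `|T x| <= `|x|) -> bounded_operator T.
Proof.
move=> lT bT; split=> // x; apply/cvgrPdist_lt => r r0.
have TB u v : T u - T v = T (u - v).
  by have := lT (-1) v u; rewrite !scaleN1r addrC => <-; rewrite addrC.
have := nbhsx_ballx x r r0; rewrite -ball_normE.
by apply: filterS => y /=; rewrite TB; apply: le_lt_trans.
Qed.

Lemma isometry_norm (H K : hilbertType R) (T : H -> K) (x : H) :
  inner (T x) (T x) = inner x x -> `|T x| = `|x|.
Proof.
rewrite !inner_normE => /eqP; rewrite eqrXn2 ?normr_ge0 //.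
by move/eqP.
Qed.

Lemma adjoint_unitary (H K : hilbertType R) (W : H -> K) (W' : K -> H) :
  linear W -> linear W' -> adjoint W W' -> cancel W W' -> cancel W' W ->
  unitary W.
Proof.
move=> lW lW' adj WK W'K; split; last exists W'; last split=> //.
- apply: contraction_bounded => // x.
  by rewrite (isometry_norm (T := W)) // adj WK.
- apply: contraction_bounded => // y.
  by rewrite (isometry_norm (T := W')) // -adj W'K.
Qed.

Lemma projection_bounded (H : hilbertType R) (e : nat -> H) :
  orthosys e -> bounded_operator (osum e e).
Proof.
move=> oe; apply: contraction_bounded; first exact: osum_linear.
move=> x; have [->|Px0] := eqVneq (osum e e x) 0; first by rewrite normr0.
have h : inner (osum e e x) (osum e e x) = inner x (osum e e x).
  by rewrite osum_adjoint // osum_idem.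
have := cauchy_schwarz x (osum e e x).
rewrite -h inner_normE ger0_norm ?exprn_ge0 // expr2.
by rewrite ler_pM2r // normr_gt0.
Qed.

Definition orthobasis (H : hilbertType R) (e : nat -> H) : Prop :=
  orthosys e /\ total_seq e.

Lemma osum_cancel (H K : hilbertType R) (e : nat -> H) (f : nat -> K) :
  orthobasis e -> orthosys f -> (forall i, f i != 0) ->
  cancel (osum e f) (osum f e).
Proof.
move=> [oe te] of_ f0 x; rewrite -[RHS](osum_total x oe te).
have Ef i : inner (osum e f x) (f i) = inner x (e i).
  by rewrite osum_inner // f0 mul1r.
by rewrite /osum; congr (limn (series _)); apply/funext => i; rewrite Ef.
Qed.

Lemma osum_unitary (H K : hilbertType R) (e : nat -> H) (f : nat -> K) :
  orthobasis e -> orthobasis f ->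
  (forall i, e i != 0) -> (forall i, f i != 0) -> unitary (osum e f).
Proof.
move=> be bf e0 f0; have [[oe _] [of_ _]] := (be, bf).
apply: (@adjoint_unitary _ _ _ (osum f e)).
- exact: osum_linear.
- exact: osum_linear.
- by move=> x y; rewrite osum_adjoint.
- exact: osum_cancel.
- exact: osum_cancel.
Qed.

(** Both sides are compared through their inner products with [f i]: self-adjointness moves [T] and
    [T'] onto basis vectors, where they act by the same [s] and [p]. *)
Lemma osum_intertwine (H K : hilbertType R) (e : nat -> H) (f : nat -> K)
    (T : H -> H) (T' : K -> K) (s : nat -> C) (p : nat -> nat) :
  orthosys e -> orthobasis f -> (forall i, f i != 0) ->
  self_adjoint T -> self_adjoint T' ->
  (forall i, T (e i) = s i *: e (p i)) -> (forall i, T' (f i) = s i *: f (p i)) ->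
  forall x, osum e f (T x) = T' (osum e f x).
Proof.
move=> oe [of_ tf] f0 sT sT' Te Tf x.
apply/eqP; rewrite -subr_eq0; apply/eqP/tf => i.
rewrite innerBl sT' Tf innerZr !osum_inner // !f0 !mul1r.
by rewrite sT Te innerZr subrr.
Qed.

End Osum.

Section GramSchmidt.
Context {R : realType} {H : hilbertType R}.
Variable t : nat -> H.

Definition gs_residue (s : seq H) (x : H) : H :=
  x - \sum_(v <- s) inner x v *: v.

(* [gs_step] is [0] when [x] lies in the span of [s], as [0^-1 = 0]. *)
Definition gs_step (s : seq H) (x : H) : H :=
  `|gs_residue s x|^-1 *: gs_residue s x.

Fixpoint gs_seq (n : nat) : seq H :=
  if n is m.+1 then rcons (gs_seq m) (gs_step (gs_seq m) (t m)) else [::].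

Definition gram_schmidt (n : nat) : H := gs_step (gs_seq n) (t n).

Lemma gs_seqE n : gs_seq n = [seq gram_schmidt i | i <- iota 0 n].
Proof.
elim: n => // n IHn.
by rewrite -addn1 iotaD map_cat -IHn /= add0n addn1 /= cats1.
Qed.

Lemma gs_residueE n :
  gs_residue (gs_seq n) (t n) =
    t n - \sum_(0 <= i < n) inner (t n) (gram_schmidt i) *: gram_schmidt i.
Proof. by rewrite /gs_residue gs_seqE big_map /index_iota subn0. Qed.

Lemma gram_schmidt_normed n :
  inner (gram_schmidt n) (gram_schmidt n) = (gram_schmidt n != 0)%:R.
Proof.
rewrite /gram_schmidt /gs_step; set r := gs_residue _ _.
have [->|r0] := eqVneq r 0; first by rewrite !scaler0 inner0l eqxx.
have nr0 : `|r| != 0 by rewrite normr_eq0.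
rewrite scaler_eq0 invr_eq0 (negPf nr0) (negPf r0) innerZl innerZr inner_normE.
rewrite fmorphV /= geC0_conj // expr2; apply/eqP; rewrite mulrA -invfM.
by rewrite mulVf // mulf_neq0.
Qed.

Lemma gram_schmidt_lt_orth n i : (i < n)%N -> inner (gram_schmidt n) (gram_schmidt i) = 0.
Proof.
elim/ltn_ind: n i => n IHn i lt_in.
rewrite {1}/gram_schmidt /gs_step innerZl; apply/eqP; rewrite mulf_eq0.
apply/orP; right; rewrite gs_residueE innerBl inner_suml; apply/eqP.
rewrite (bigD1_seq i) ?iota_uniq ?mem_index_iota //=.
rewrite big1_seq => [|j /andP[ji]]; last first.
  rewrite mem_index_iota /= => lt_jn; rewrite innerZl.
  have [lt_ij|] := ltnP i j; first by rewrite IHn ?mulr0.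
  rewrite leq_eqVlt (negPf ji) /= => lt_ji.
  by rewrite (inner_eq0C (IHn _ _ _ lt_ji)) ?mulr0.
rewrite addr0 innerZl gram_schmidt_normed.
have [->|_] := eqVneq (gram_schmidt i) 0; last by rewrite mulr1 subrr.
by rewrite inner0r mul0r subrr.
Qed.

Lemma gram_schmidt_orthosys : orthosys gram_schmidt.
Proof.
split; last exact: gram_schmidt_normed.
move=> i j; rewrite neq_ltn => /orP[|] h; last exact: gram_schmidt_lt_orth.
exact/inner_eq0C/gram_schmidt_lt_orth.
Qed.

(** Dual form of the fact that each [t n] is a combination of the new vectors; when the residue is
    zero, the earlier ones suffice. *)
Lemma gram_schmidt_orth y :
  (forall i, inner y (gram_schmidt i) = 0) -> forall i, inner y (t i) = 0.
Proof.
move=> yg n; have := yg n; rewrite {1}/gram_schmidt /gs_step innerZr.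
have [/eqP|r0] := eqVneq (gs_residue (gs_seq n) (t n)) 0.
  rewrite gs_residueE subr_eq0 => /eqP-> _.
  by rewrite inner_sumr big1 // => i _; rewrite innerZr yg mulr0.
move/eqP; rewrite mulf_eq0 fmorph_eq0 invr_eq0 normr_eq0 (negPf r0) /=.
rewrite gs_residueE innerBr inner_sumr big1 ?subr0 => [/eqP//|i _].
by rewrite innerZr yg mulr0.
Qed.

Lemma gram_schmidt_span (S : H -> Prop) :
  S 0 -> (forall (a : R[i]) x y, S x -> S y -> S (a *: x + y)) ->
  (forall i, S (t i)) -> forall i, S (gram_schmidt i).
Proof.
move=> S0 SD St; elim/ltn_ind => n IHn.
have SZ (a : R[i]) x : S x -> S (a *: x) by move=> Sx; rewrite -[_ *: _]addr0; apply: (SD).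
apply: (SZ); rewrite gs_residueE addrC -scaleN1r; apply: (SD) => //.
rewrite big_seq; apply: (big_ind S) => [//|x y Sx Sy|i].
  by rewrite -[x]scale1r; apply: (SD).
by rewrite mem_index_iota => /andP[_ lt_in]; apply/SZ/IHn.
Qed.

End GramSchmidt.

(** * Systems of anticommuting pairs of reflections *)

Lemma opp_self_eq0 (C : numDomainType) (a : C) : a = - a -> a = 0.
Proof.
by move=> /eqP; rewrite -addr_eq0 -mulr2n mulrn_eq0 /= => /eqP.
Qed.

Section PauliSystem.
Context {R : realType} {H : hilbertType R}.
Local Notation C := R[i].

Record pauli_system (P Q : nat -> H -> H) : Prop := PauliSystem {
  pauliP_linear : forall i, linear (P i);
  pauliQ_linear : forall i, linear (Q i);
  pauliP_sa : forall i, self_adjoint (P i);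
  pauliQ_sa : forall i, self_adjoint (Q i);
  pauliPK : forall i, involutive (P i);
  pauliQK : forall i, involutive (Q i);
  pauliPP : forall i j x, P i (P j x) = P j (P i x);
  pauliQQ : forall i j x, Q i (Q j x) = Q j (Q i x);
  pauliPQ : forall i j x, P i (Q j x) = (-1) ^+ (i == j) *: Q j (P i x) }.

(** An orthonormal basis of the subspace [S]; without zero vectors, two of them can be matched index
    by index. *)
Definition subbasis (S : H -> Prop) (e : nat -> H) : Prop :=
  [/\ orthosys e, forall i, e i != 0, forall i, S (e i) &
      forall x, S x -> (forall i, inner x (e i) = 0) -> x = 0].

Variables P Q : nat -> H -> H.
Hypothesis PQ : pauli_system P Q.

Let PD i := linmapD (pauliP_linear PQ i).
Let P0 i := linmap0 (pauliP_linear PQ i).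
Let PZ i := linmapZ (pauliP_linear PQ i).
Let Q0 i := linmap0 (pauliQ_linear PQ i).
Let QN i := linmapN (pauliQ_linear PQ i).

Let PQi i x : P i (Q i x) = - Q i (P i x).
Proof. by rewrite (pauliPQ PQ) eqxx expr1 scaleN1r. Qed.

Let PQn i j x : i != j -> P i (Q j x) = Q j (P i x).
Proof. by move=> /negPf ij; rewrite (pauliPQ PQ) ij scale1r. Qed.

(** The window shrinks from [0 <= i < n], the fixed space of the first [n] reflections, to the empty
    one, the whole space; each step doubles the basis. *)
Definition fixed (m n : nat) (x : H) : Prop :=
  forall i, (m <= i < n)%N -> P i x = x.

Lemma fixed_lin m n (a : C) x y :
  fixed m n x -> fixed m n y -> fixed m n (a *: x + y).
Proof. by move=> fx fy i mi; rewrite PD PZ fx ?fy. Qed.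

Lemma fixed0 m n : fixed m n 0.
Proof. by move=> i _; exact: P0. Qed.

(** Anticommutation makes [Q i] carry the fixed vectors of [P i] to its eigenvalue [-1], and
    distinct eigenspaces of a self-adjoint operator are orthogonal. *)
Lemma pauli_orth i x y : P i x = x -> P i y = y -> inner x (Q i y) = 0.
Proof.
move=> Px Py; apply: opp_self_eq0.
by rewrite -{1}Px (pauliP_sa PQ) PQi Py innerNr.
Qed.

Definition dbl (T : H -> H) (e : nat -> H) (l : nat) : H :=
  if odd l then T (e l./2) else e l./2.

Lemma subbasis_dbl m n e : (m < n)%N ->
  subbasis (fixed m n) e -> subbasis (fixed m.+1 n) (dbl (Q m) e).
Proof.
move=> mn [[eo en] e0 ef te].
have eP i : P m (e i) = e i by apply: ef; rewrite leqnn.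
have Qinn x y : inner (Q m x) (Q m y) = inner x y.
  by rewrite (pauliQ_sa PQ) (pauliQK PQ).
have en0 i : inner (e i) (e i) = 1 by rewrite en e0.
split.
- split=> [i j ij|i]; last first.
    rewrite /dbl; case: ifP => _; rewrite ?Qinn en0.
      suff -> : Q m (e i./2) != 0 by [].
      by apply/eqP => /(congr1 (Q m)); rewrite (pauliQK PQ) Q0; apply/eqP.
    by rewrite e0.
  rewrite /dbl.
  have [oi|oi] := boolP (odd i); have [oj|oj] := boolP (odd j).
  + rewrite Qinn; apply: eo; apply: contraNneq ij => h.
    by rewrite -(odd_double_half i) -(odd_double_half j) oi oj h.
  + by apply: inner_eq0C; apply: pauli_orth.
  + exact: pauli_orth.
  + apply: eo; apply: contraNneq ij => h.
    by rewrite -(odd_double_half i) -(odd_double_half j) (negPf oi) (negPf oj) h.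
- move=> l; rewrite /dbl; case: ifP => // _.
  apply/eqP => /(congr1 (Q m)); rewrite (pauliQK PQ) Q0; exact/eqP.
- move=> l i /andP[mi ni]; rewrite /dbl.
  have Pe : P i (e l./2) = e l./2 by apply: ef; rewrite ltnW.
  by case: ifP => _ //; rewrite PQn ?Pe // gtn_eqF.
move=> y fy yo.
have ye i : inner y (e i) = 0 by have := yo i.*2; rewrite /dbl odd_double doubleK.
have yq i : inner y (Q m (e i)) = 0.
  by have := yo i.*2.+1; rewrite /dbl /= odd_double /= uphalf_double.
(* This is twice the component of [y] fixed by [P m]: it lies in the smaller fixed space and is
   orthogonal to [e]. What remains of [y] has eigenvalue [-1], and [Q m] brings it into that same
   space. *)
have yp : y + P m y = 0.
  apply: te => [i|i].
    rewrite leq_eqVlt => /andP[/orP[/eqP<- _|mi ni]].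
      by rewrite PD (pauliPK PQ) addrC.
    by rewrite PD (pauliPP PQ i m) !(fy i) ?mi.
  by rewrite innerDl (pauliP_sa PQ) eP ye addr0.
have Py : P m y = - y by apply/eqP; rewrite -addr_eq0 addrC yp.
suff : Q m y = 0 by move/(congr1 (Q m)); rewrite (pauliQK PQ) Q0.
apply: te => [i|i]; last by rewrite (pauliQ_sa PQ).
rewrite leq_eqVlt => /andP[/orP[/eqP<- _|mi ni]].
  by rewrite PQi Py QN opprK.
by rewrite PQn ?fy ?mi ?ni // gtn_eqF.
Qed.

Fixpoint pbasis (e : nat -> H) (m : nat) : nat -> H :=
  if m is k.+1 then dbl (Q k) (pbasis e k) else e.

Lemma subbasis_pbasis n e m : (m <= n)%N ->
  subbasis (fixed 0 n) e -> subbasis (fixed m n) (pbasis e m).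
Proof.
by elim: m => [//|m IHm] mn be; apply/subbasis_dbl/IHm => //; apply: ltnW.
Qed.

End PauliSystem.

(* [pauli_sign m i l] is the binary digit of weight [2 ^ (m - 1 - i)] of the label
   [l] of [pbasis e m], and [pauli_flip m i] flips this digit. *)
Fixpoint pauli_sign (m i l : nat) : bool :=
  if m is k.+1 then if i == k then odd l else pauli_sign k i l./2 else false.

Fixpoint pauli_flip (m i l : nat) : nat :=
  if m is k.+1 then
    if i == k then (~~ odd l + l./2.*2)%N
    else (odd l + (pauli_flip k i l./2).*2)%N
  else l.

Section PauliAction.
Context {R : realType} {H : hilbertType R}.
Variables P Q : nat -> H -> H.
Hypothesis PQ : pauli_system P Q.
Variables (n : nat) (e : nat -> H).
Hypothesis be : subbasis (fixed P 0 n) e.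

Lemma pbasis_P m i l : (m <= n)%N -> (i < m)%N ->
  P i (pbasis Q e m l) = (-1) ^+ pauli_sign m i l *: pbasis Q e m l.
Proof.
elim: m l => // m IHm l mn; rewrite ltnS leq_eqVlt /= /dbl.
have [->|im /= lt_im] := eqVneq i m.
  have [_ _ bf _] := subbasis_pbasis PQ (ltnW mn) be.
  have Pb : P m (pbasis Q e m l./2) = pbasis Q e m l./2 by apply: bf; rewrite leqnn.
  case: (odd l) => /=; last by rewrite scale1r.
  by rewrite (pauliPQ PQ) eqxx Pb.
have IH := IHm l./2 (ltnW mn) lt_im.
case: (odd l); last exact: IH.
by rewrite (pauliPQ PQ) (negPf im) scale1r IH (linmapZ (pauliQ_linear PQ m)).
Qed.

Lemma pbasis_Q m i l : (i < m)%N ->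
  Q i (pbasis Q e m l) = pbasis Q e m (pauli_flip m i l).
Proof.
elim: m l => // m IHm l; rewrite ltnS leq_eqVlt /= /dbl.
have [->|im /= lt_im] := eqVneq i m.
  rewrite oddD odd_double addbF halfD odd_double andbF add0n doubleK.
  by case: (odd l); rewrite /= ?(pauliQK PQ) ?add0n.
have IH := IHm l./2 lt_im.
rewrite oddD odd_double addbF halfD odd_double andbF add0n doubleK.
by case: (odd l); rewrite /= ?add0n ?(pauliQQ PQ i m) IH.
Qed.

End PauliAction.

(** Serves twice: to skip the zero vectors of a Gram-Schmidt sequence, and to number the pivots. *)
Lemma infinite_enum (p : pred nat) :
  (forall N, exists2 i, (N <= i)%N & p i) ->
  exists f : nat -> nat,
    [/\ injective f, forall i, p (f i) & forall j, p j -> exists i, f i = j].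
Proof.
move=> hp.
have pinf : infinite_set [set i | p i].
  move=> /finite_seqP[X pX].
  have [i Xi pi] := hp (\max_(j <- X) j).+1.
  have : i \in X by have : [set` X] i by rewrite -pX.
  by move=> iX; have := @leq_bigmax_seq nat X xpredT id i iX isT; rewrite leqNgt Xi.
have /card_esym/card_set_bijP[f [fp finj fsurj]] :=
  eq_card_nat (countableP _) pinf.
exists f; split => [i j fij|i|j pj].
- by apply: finj => //; rewrite inE.
- exact: (fp i I).
- by have [i _ <-] := fsurj j pj; exists i.
Qed.

Section FixedSubspace.
Context {R : realType} {H : hilbertType R}.
Local Notation C := R[i].
Variables P Q : nat -> H -> H.
Hypothesis PQ : pauli_system P Q.

(** The product of the commuting projections [(1 + P i) / 2] for [i < n]. *)
Fixpoint fixed_proj (n : nat) (x : H) : H :=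
  if n is k.+1 then 2^-1 *: (fixed_proj k x + P k (fixed_proj k x)) else x.

Let linP i := pauliP_linear PQ i.

Let half2 (x : H) : (2^-1 : C) *: (x + x) = x.
Proof.
rewrite -[X in X + _]scale1r -[X in _ + X]scale1r -scalerDl scalerA.
by rewrite mulVf ?scale1r ?pnatr_eq0.
Qed.

Lemma fixed_projC n i x : fixed_proj n (P i x) = P i (fixed_proj n x).
Proof.
elim: n => //= n ->.
by rewrite (linmapZ (linP i)) (linmapD (linP i)) (pauliPP PQ n i).
Qed.

Lemma fixed_proj_fixed n x : fixed P 0 n (fixed_proj n x).
Proof.
elim: n => [i|n IHn i] //=; rewrite ltnS leq_eqVlt => /orP[/eqP->|lt_in].
  by rewrite (linmapZ (linP n)) (linmapD (linP n)) (pauliPK PQ) addrC.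
rewrite (linmapZ (linP i)) (linmapD (linP i)) (pauliPP PQ i n).
by rewrite IHn.
Qed.

Lemma fixed_proj_id n x : fixed P 0 n x -> fixed_proj n x = x.
Proof.
elim: n => //= n IHn fx; rewrite IHn => [|i /= lt_in].
  by rewrite fx ?half2 /=.
by apply: fx; rewrite /= ltnW.
Qed.

Lemma fixed_proj_sa n : self_adjoint (fixed_proj n).
Proof.
elim: n => //= n IHn x y.
rewrite innerZl innerDl (pauliP_sa PQ) !IHn innerZr innerDr fixed_projC.
by rewrite fmorphV /= rmorph_nat.
Qed.

Lemma fixed_nonzero n : (exists x : H, x != 0) ->
  exists2 v, v != 0 & fixed P 0 n v.
Proof.
move=> [x x0]; elim: n => [|n [v v0 fv]]; first by exists x.
have [vP|vP] := eqVneq (v + P n v) 0; last first.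
  exists (v + P n v) => // i /=; rewrite ltnS leq_eqVlt => /orP[/eqP->|lt_in].
    by rewrite (linmapD (linP n)) (pauliPK PQ) addrC.
  by rewrite (linmapD (linP i)) (pauliPP PQ i n) fv.
(* Otherwise [v] has eigenvalue [-1] for [P n]; [Q n] turns it into [1] and keeps the eigenvalues of
   the earlier reflections. *)
exists (Q n v).
  apply: contraNneq v0 => /(congr1 (Q n)).
  by rewrite (pauliQK PQ) (linmap0 (pauliQ_linear PQ n)) => ->.
move=> i /=; rewrite ltnS (pauliPQ PQ) leq_eqVlt.
have [->{i} _|ni /= lt_in] := eqVneq i n; last by rewrite fv ?scale1r.
have -> : P n v = - v by apply/eqP; rewrite -addr_eq0 addrC vP.
by rewrite (linmapN (pauliQ_linear PQ n)) expr1 scaleN1r opprK.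
Qed.

(* If the [e i] vanish from rank [N] on, the fixed subspace has dimension at
   most [N], whereas it contains the [N + 1] orthogonal vectors [Q (n + i) v]. *)
Lemma fixed_infinite n (e : nat -> H) : (exists x : H, x != 0) ->
  orthosys e -> (forall i, fixed P 0 n (e i)) ->
  (forall x, fixed P 0 n x -> (forall i, inner x (e i) = 0) -> x = 0) ->
  forall N, exists2 i, (N <= i)%N & e i != 0.
Proof.
move=> H0 [eo en] ef te N; apply: contrapT => hN.
have eN i : (N <= i)%N -> e i = 0.
  by move=> Ni; apply/eqP; apply: contrapT => /negP ei; apply: hN; exists i.
have [v v0 fv] := fixed_nonzero (n + N.+1) H0.
pose u (i : 'I_N.+1) := Q (n + i) v.
have vP (i : 'I_N.+1) : P (n + i) v = v by apply: fv; rewrite /= ltn_add2l.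
have uu i j : inner (u i) (u j) = (i == j)%:R * inner v v.
  have [<-|ij] := eqVneq i j.
    by rewrite (pauliQ_sa PQ) (pauliQK PQ) mul1r.
  rewrite mul0r; apply: opp_self_eq0.
  rewrite -[in RHS]innerNl.
  have -> : - u i = P (n + i) (u i).
    by rewrite (pauliPQ PQ) eqxx vP expr1 scaleN1r.
  have Pj : P (n + i) (u j) = u j.
    by rewrite (pauliPQ PQ) eqn_add2l (val_eqE i j) (negPf ij) vP scale1r.
  by rewrite (pauliP_sa PQ) Pj.
have fu i : fixed P 0 n (u i).
  move=> k /= lt_kn; rewrite (pauliPQ PQ) fv /= ?ltn_addr //.
  by rewrite ltn_eqF ?scale1r // ltn_addr.
have uE i : u i = \sum_(j < N) inner (u i) (e j) *: e j.
  apply/eqP; rewrite -subr_eq0; apply/eqP/te => [|k].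
    rewrite -[X in X - _]scale1r -scaleN1r [_ *: u i + _]addrC.
    apply: (fixed_lin PQ) => //; last by rewrite scale1r.
    apply: (big_ind (fixed P 0 n)); first exact: (fixed0 PQ).
      by move=> x y fx fy; rewrite -[x]scale1r; apply: (fixed_lin PQ).
    by move=> j _; rewrite -[_ *: _]addr0; apply: (fixed_lin PQ) => //; apply: (fixed0 PQ).
  rewrite innerBl inner_suml.
  have [Nk|lt_kN] := leqP N k.
    by rewrite eN // !inner0r big1 ?subr0 // => j _; rewrite inner0r.
  rewrite (bigD1 (Ordinal lt_kN)) //= big1 => [|j jk]; last first.
    by rewrite innerZl eo ?mulr0.
  rewrite addr0 innerZl en.
  have [->|_] := eqVneq (e k) 0; last by rewrite mulr1 subrr.
  by rewrite inner0r mul0r subrr.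
(* The coordinates of the [N + 1] vectors [u i] in the [N] vectors [e j] would factor the identity
   of size [N + 1] through dimension [N]. *)
pose A : 'M[C]_(N.+1, N) := \matrix_(i, j) inner (u i) (e j).
pose B : 'M[C]_(N, N.+1) := \matrix_(j, i) ((inner v v)^-1 * inner (e j) (u i)).
have AB : A *m B = 1%:M.
  apply/matrixP => i k; rewrite !mxE.
  under eq_bigr => j _ do rewrite !mxE mulrCA -innerZl.
  rewrite -mulr_sumr -inner_suml -uE uu mulrCA mulVf ?mulr1 //.
  by apply: contraNneq v0 => /inner_self_eq0 ->.
by have := mulmx1_min AB; rewrite ltnn.
Qed.

(** The projection is self-adjoint and is the identity on the fixed subspace, so it carries a total
    sequence to one that is total there. Orthonormalizing and skipping the zero vectors gives the
    basis. *)
Lemma fixed_subbasis n (t : nat -> H) : (exists x : H, x != 0) ->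
  total_seq t -> exists e, subbasis (fixed P 0 n) e.
Proof.
move=> H0 tt.
pose g := gram_schmidt (fun j => fixed_proj n (t j)).
have og : orthosys g by apply: gram_schmidt_orthosys.
have fg : forall i, fixed P 0 n (g i).
  apply: gram_schmidt_span; first exact: (fixed0 PQ).
    by move=> a x y; exact: (fixed_lin PQ).
  by move=> i; exact: fixed_proj_fixed.
have tg x : fixed P 0 n x -> (forall i, inner x (g i) = 0) -> x = 0.
  move=> fx /gram_schmidt_orth xt; apply: tt => i.
  by rewrite -(fixed_proj_id fx) fixed_proj_sa.
have [f [finj f0 fsurj]] := infinite_enum (fixed_infinite H0 og fg tg).
exists (g \o f); split=> //=.
- split=> [i j ij|i] /=; last by rewrite og.2.
  by apply: og.1; apply: contraNneq ij => /finj ->.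
- move=> x fx xg; apply: tg => // i.
  have [->|/fsurj[k <-]] := eqVneq (g i) 0; first by rewrite inner0r.
  exact: xg.
Qed.

End FixedSubspace.

Lemma pauli_intertwine (R : realType) (H K : hilbertType R)
    (P Q : nat -> H -> H) (P' Q' : nat -> K -> K)
    (t : nat -> H) (t' : nat -> K) :
  pauli_system P Q -> pauli_system P' Q' ->
  (exists x : H, x != 0) -> (exists y : K, y != 0) ->
  total_seq t -> total_seq t' ->
  forall n, exists W : H -> K, unitary W /\ forall i, (i < n)%N ->
    (forall x, W (P i x) = P' i (W x)) /\ (forall x, W (Q i x) = Q' i (W x)).
Proof.
move=> PQ PQ' H0 K0 tt tt' n.
have [e be] := fixed_subbasis PQ n H0 tt.
have [e' be'] := fixed_subbasis PQ' n K0 tt'.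
have [oB B0 _ tB] := subbasis_pbasis PQ (leqnn n) be.
have [oB' B'0 _ tB'] := subbasis_pbasis PQ' (leqnn n) be'.
(* At [m = n] the window is empty, so the basis obtained is one of the whole space. *)
have fixed_nil (L : hilbertType R) (S : nat -> L -> L) x : fixed S n n x.
  by move=> i /andP[ni]; rewrite ltnNge ni.
have bB : orthobasis (pbasis Q e n) by split=> // x; apply: tB.
have bB' : orthobasis (pbasis Q' e' n) by split=> // x; apply: tB'.
exists (osum (pbasis Q e n) (pbasis Q' e' n)); split; first exact: osum_unitary.
move=> i lt_in; split.
  apply: (osum_intertwine (s := fun l => (-1) ^+ pauli_sign n i l) (p := id)) => //.
  - exact: (pauliP_sa PQ).
  - exact: (pauliP_sa PQ').
  - by move=> l; apply: (pbasis_P PQ be).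
  - by move=> l; apply: (pbasis_P PQ' be').
apply: (osum_intertwine (s := fun=> 1) (p := pauli_flip n i)) => //.
- exact: (pauliQ_sa PQ).
- exact: (pauliQ_sa PQ').
- by move=> l; rewrite scale1r; apply: (pbasis_Q PQ).
- by move=> l; rewrite scale1r; apply: (pbasis_Q PQ').
Qed.

(** * Words in a spin system *)

Lemma F2P (a : 'F_2) : a = 0 \/ a = 1.
Proof. by case: a => -[|[|//]] lt_a; [left|right]; apply/val_inj. Qed.

Lemma F2_addrr (a : 'F_2) : a + a = 0.
Proof. by case: (F2P a) => ->; apply/val_inj. Qed.

Section Sign2.
Context {R : realType}.
Implicit Types a b : 'F_2.

Lemma sign2_0 : sign2 0 = 1 :> R[i].
Proof. by []. Qed.

Lemma sign2_1 : sign2 1 = -1 :> R[i].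
Proof. by rewrite /sign2 expr1. Qed.

Lemma sign2D a b : sign2 (a + b) = sign2 a * sign2 b :> R[i].
Proof.
case: (F2P a) => ->; first by rewrite add0r sign2_0 mul1r.
case: (F2P b) => ->; first by rewrite addr0 sign2_0 mulr1.
by rewrite F2_addrr sign2_0 sign2_1 mulrNN mulr1.
Qed.

Lemma sign2K a : sign2 a * sign2 a = 1 :> R[i].
Proof. by rewrite -sign2D F2_addrr. Qed.

Lemma sign2_neq0 a : sign2 a != 0 :> R[i].
Proof. by rewrite signr_eq0. Qed.

Lemma sign2_conj a : (sign2 a)^* = sign2 a :> R[i].
Proof. by rewrite /sign2 rmorph_sign. Qed.

Lemma sign2_inj a b : sign2 a = sign2 b :> R[i] -> a = b.
Proof.
have N1 : (-1 : R[i]) <> 1.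
  by move/eqP; rewrite eq_sym -addr_eq0 -mulr2n pnatr_eq0.
case: (F2P a) => ->; case: (F2P b) => -> //.
  by rewrite sign2_0 sign2_1 => /esym/N1.
Qed.

End Sign2.

(* A word [w] stands for the element of [Gamma] whose [k]-th coordinate is the
   parity of the number of occurrences of [k] in [w]. *)
Section WordForm.
Variable c : nat -> nat -> 'F_2.
Hypothesis c_sym : forall i j, c i j = c j i.
Hypothesis c_diag : forall i, c i i = 0.
Implicit Types w v : seq nat.

Definition word_form w v : 'F_2 := \sum_(i <- w) \sum_(j <- v) c i j.

(** The sum of [c] over the pairs of positions of [w]: the exponent of the sign that the product
    acquires when the word is reversed. *)
Fixpoint word_quad w : 'F_2 :=
  if w is k :: v then word_form [:: k] v + word_quad v else 0.

Lemma word_form_catl w w' v :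
  word_form (w ++ w') v = word_form w v + word_form w' v.
Proof. by rewrite /word_form big_cat. Qed.

Lemma word_form_nill v : word_form [::] v = 0.
Proof. by rewrite /word_form big_nil. Qed.

Lemma word_formC w v : word_form w v = word_form v w.
Proof.
rewrite /word_form exchange_big; apply: eq_bigr => i _.
by apply: eq_bigr => j _; exact: c_sym.
Qed.

Lemma word_form_catr w v v' :
  word_form w (v ++ v') = word_form w v + word_form w v'.
Proof. by rewrite ![word_form w _]word_formC word_form_catl. Qed.

Lemma word_form_nilr w : word_form w [::] = 0.
Proof. by rewrite word_formC word_form_nill. Qed.

Lemma word_form_consl k w v :
  word_form (k :: w) v = word_form [:: k] v + word_form w v.
Proof. by rewrite -cat1s word_form_catl. Qed.

Lemma word_form_consr k w v :
  word_form v (k :: w) = word_form v [:: k] + word_form v w.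
Proof. by rewrite -cat1s word_form_catr. Qed.

Lemma word_form1 i j : word_form [:: i] [:: j] = c i j.
Proof. by rewrite /word_form !big_seq1. Qed.

Lemma word_form_self w : word_form w w = 0.
Proof.
elim: w => [|k w IHw]; first exact: word_form_nill.
rewrite word_form_consl !(word_form_consr k w) word_form1 c_diag add0r IHw addr0.
by rewrite [word_form w _]word_formC F2_addrr.
Qed.

Definition word_ker w : Prop := forall k, word_form w [:: k] = 0.

Lemma word_kerP w v : word_ker w -> word_form w v = 0.
Proof.
move=> kw; elim: v => [|k v IHv]; first exact: word_form_nilr.
by rewrite word_form_consr kw IHv addr0.
Qed.

Lemma word_ker_cat w v : word_ker w -> word_ker v -> word_ker (w ++ v).
Proof. by move=> kw kv k; rewrite word_form_catl kw kv addr0. Qed.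

End WordForm.

Fixpoint wordop (T : Type) (U : nat -> T -> T) (w : seq nat) (x : T) : T :=
  if w is k :: v then U k (wordop U v x) else x.

Lemma wordop_cat (T : Type) (U : nat -> T -> T) w v x :
  wordop U (w ++ v) x = wordop U w (wordop U v x).
Proof. by elim: w => //= k w ->. Qed.

Section SpinWords.
Context {R : realType} {H : hilbertType R}.
Local Notation C := R[i].
Variables (c : nat -> nat -> 'F_2).
Hypothesis c_sym : forall i j, c i j = c j i.
Hypothesis c_diag : forall i, c i i = 0.
Variables (U : nat -> H -> H).
Hypothesis sU : spin_system c U.
Implicit Types w v : seq nat.

Lemma spin_linear k : linear (U k).
Proof. by have [_ _ uU _] := sU; case: (uU k) => -[]. Qed.

Lemma spin_sa k : self_adjoint (U k).
Proof. by have [_ sa _ _] := sU. Qed.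

Lemma spinK k : involutive (U k).
Proof.
have [_ sa uU _] := sU; have [_ [U' [_ adj UK _]]] := uU k.
by move=> x; apply: inner_inj => z; rewrite sa adj UK.
Qed.

Lemma wordop_linear w : linear (wordop U w).
Proof. by move=> a x y; elim: w => //= k w ->; rewrite spin_linear. Qed.

Lemma wordopZ w (a : C) x : wordop U w (a *: x) = a *: wordop U w x.
Proof. exact: linmapZ (wordop_linear w) a x. Qed.

Lemma wordop_adjoint w x y :
  inner (wordop U w x) y = inner x (wordop U (rev w) y).
Proof.
elim: w y => //= k w IHw y.
by rewrite spin_sa IHw rev_cons -cats1 wordop_cat.
Qed.

Lemma wordop_revK w : cancel (wordop U w) (wordop U (rev w)).
Proof.
elim: w => //= k w IHw x.
by rewrite rev_cons -cats1 wordop_cat /= spinK IHw.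
Qed.

Lemma wordopK_rev w : cancel (wordop U (rev w)) (wordop U w).
Proof. by move=> x; rewrite -{1}[w]revK wordop_revK. Qed.

Lemma wordop_comm w v x :
  wordop U w (wordop U v x) =
    sign2 (word_form c w v) *: wordop U v (wordop U w x).
Proof.
have [_ _ _ cU] := sU.
have comm1 k u y :
    U k (wordop U u y) = sign2 (word_form c [:: k] u) *: wordop U u (U k y).
  elim: u y => [|j u IHu] y /=; first by rewrite word_form_nilr ?scale1r.
  rewrite cU IHu (linmapZ (spin_linear j)) scalerA.
  by rewrite (word_form_consr c_sym) word_form1 sign2D.
elim: w => [|k w IHw] /=; first by rewrite word_form_nill scale1r.
rewrite IHw (linmapZ (spin_linear k)) comm1 scalerA.
by rewrite (word_form_consl c k w) sign2D mulrC.
Qed.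

Lemma wordop_rev w x :
  wordop U (rev w) x = sign2 (word_quad c w) *: wordop U w x.
Proof.
elim: w x => [|k w IHw] x /=; first by rewrite scale1r.
rewrite rev_cons -cats1 wordop_cat /= IHw -[U k x]/(wordop U [:: k] x).
by rewrite (wordop_comm w) scalerA -sign2D addrC (word_formC c_sym w).
Qed.

(* The phase makes [wordop U w], whose square is [sign2 (word_quad c w)],
   self-adjoint. *)
Definition word_phase w : C := 'i ^+ (word_quad c w : nat).

Definition herm_wordop w (x : H) : H := word_phase w *: wordop U w x.

Lemma word_phaseK w : word_phase w * word_phase w = sign2 (word_quad c w).
Proof. by rewrite -expr2 exprAC sqrCi. Qed.

Lemma word_phase_conj w :
  (word_phase w)^* = sign2 (word_quad c w) * word_phase w.
Proof.
rewrite /word_phase rmorphXn /= conjCi.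
case: (F2P (word_quad c w)) => ->; first by rewrite !expr0 mul1r.
by rewrite sign2_1 !expr1 mulN1r.
Qed.

Lemma word_phase_neq0 w : word_phase w != 0.
Proof. by rewrite expf_neq0 // neq0Ci. Qed.

Lemma herm_wordop_linear w : linear (herm_wordop w).
Proof.
by move=> a x y; rewrite /herm_wordop wordop_linear scalerDr !scalerA mulrC.
Qed.

Lemma herm_wordop_sa w : self_adjoint (herm_wordop w).
Proof.
move=> x y; rewrite /herm_wordop innerZl innerZr wordop_adjoint wordop_rev.
by rewrite innerZr word_phase_conj sign2_conj mulrA [word_phase w * _]mulrC.
Qed.

Lemma herm_wordopK w : involutive (herm_wordop w).
Proof.
move=> x; rewrite /herm_wordop wordopZ scalerA word_phaseK -wordopZ -wordop_rev.
exact: wordopK_rev.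
Qed.

Lemma herm_wordop_comm w v x :
  herm_wordop w (herm_wordop v x) =
    sign2 (word_form c w v) *: herm_wordop v (herm_wordop w x).
Proof.
rewrite /herm_wordop !wordopZ wordop_comm !scalerA; congr (_ *: _).
by ring.
Qed.

End SpinWords.

Section SpinParity.
Variable c : nat -> nat -> 'F_2.
Hypothesis c_sym : forall i j, c i j = c j i.

(** The sign is chosen before the system because it depends on [c] and [w] only. The first letter
    must occur again; moving it next to its copy costs a sign, and the two then cancel. *)
Lemma wordop_even (R : realType) w : (forall k, ~~ odd (count_mem k w)) ->
  exists a : 'F_2, forall (H : hilbertType R) (U : nat -> H -> H),
    spin_system c U -> forall x, wordop U w x = sign2 a *: x.
Proof.
have [n] := ubnP (size w); elim: n w => // n IHn [|k w] /= wn ew.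
  by exists 0 => H U _ x; rewrite scale1r.
have kw : k \in w.
  by have := ew k; rewrite eqxx /= negbK -has_pred1 has_count; case: count.
case/splitPr: kw wn ew => u v; rewrite size_cat /= addnS => wn ew.
have [|i|a aP] := IHn (u ++ v).
- by rewrite size_cat; apply: ltnW.
- have := ew i; rewrite !count_cat /= !oddD.
  by case: (k == i); case: (odd (count _ u)); case: (odd (count _ v)).
exists (word_form c [:: k] u + a) => H U sU x.
rewrite wordop_cat -[U k _]/(wordop U [:: k] _) (wordop_comm c_sym sU) /=.
by rewrite (spinK sU) -wordop_cat aP // scalerA sign2D.
Qed.

Lemma wordop_parity (R : realType) w v :
  (forall k, odd (count_mem k w) = odd (count_mem k v)) ->
  exists a : 'F_2, forall (H : hilbertType R) (U : nat -> H -> H),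
    spin_system c U -> forall x, wordop U w x = sign2 a *: wordop U v x.
Proof.
move=> wv; have [k|a aP] := @wordop_even R (w ++ rev v).
  by rewrite count_cat count_rev oddD wv addbb.
exists a => H U sU x; rewrite -(aP _ _ sU) wordop_cat.
by rewrite (wordop_revK sU).
Qed.

End SpinParity.

Section Irreducible.
Context {R : realType} {H : hilbertType R}.
Local Notation C := R[i].
Variables (c : nat -> nat -> 'F_2).
Hypothesis c_sym : forall i j, c i j = c j i.
Variables (U : nat -> H -> H).
Hypothesis iU : irreducible_spin_system c U.

Let sU : spin_system c U := iU.1.

Lemma irreducible_scalar (T : H -> H) :
  bounded_operator T -> (forall k x, T (U k x) = U k (T x)) ->
  exists a : C, forall x, T x = a *: x.
Proof.
move=> bT cT; have : commutant (range U) T.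
  by split=> // _ [k _ <-]; apply/funext => x; exact: cT.
by rewrite iU.2 => -[a _ <-]; exists a.
Qed.

Lemma wordop_bounded w : bounded_operator (wordop U w).
Proof.
apply: contraction_bounded; first exact: (wordop_linear sU).
move=> x; rewrite (isometry_norm (T := wordop U w)) //.
by rewrite (wordop_adjoint sU) (wordop_revK sU).
Qed.

Lemma irreducible_ker w : word_ker c w ->
  exists a : C, forall x, wordop U w x = a *: x.
Proof.
move=> kw; apply: irreducible_scalar; first exact: wordop_bounded.
move=> k x; rewrite -[U k x]/(wordop U [:: k] x) (wordop_comm c_sym sU) kw.
by rewrite scale1r.
Qed.

(** Words are countable; pickling turns the orbit of [v] into a sequence, padded with [0]. *)
Definition word_orbit (v : H) (j : nat) : H :=
  if unpickle j is Some w then wordop U w v else 0.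

Lemma word_orbit_perp v y :
  (forall j, inner y (word_orbit v j) = 0) <->
  (forall w, inner y (wordop U w v) = 0).
Proof.
split=> [h w|h j]; last by rewrite /word_orbit; case: unpickle => [w|]; rewrite ?inner0r.
by have := h (pickle w); rewrite /word_orbit pickleK.
Qed.

(* The projection onto the closed span of the orbit of [v] commutes with every
   [U k], hence is a scalar. *)
Lemma irreducible_cyclic v : v != 0 -> total_seq (word_orbit v).
Proof.
move=> v0; pose g := gram_schmidt (word_orbit v).
have og : orthosys g := gram_schmidt_orthosys _.
pose M y := forall w, inner y (wordop U w v) = 0.
have gM y : (forall i, inner y (g i) = 0) -> M y.
  by move=> yg; apply/word_orbit_perp/gram_schmidt_orth.
have Mg y : M y -> forall i, inner y (g i) = 0.
  move=> /word_orbit_perp My; apply: (gram_schmidt_span (S := fun z => inner y z = 0)) => //.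
    exact: inner0r.
  by move=> a x z yx yz; rewrite innerDr innerZr yx yz mulr0 addr0.
have MB x y : M x -> M y -> M (x - y).
  by move=> Mx My w; rewrite innerBl Mx My subrr.
have MU k x : M x -> M (U k x).
  by move=> Mx w; rewrite (spin_sa sU) -[U k _]/(wordop U (k :: w) v) Mx.
have eM x : M (x - osum g g x).
  by apply: gM => i; apply: osum_proj_orth.
have linE := osum_linear og og.
have e0 y : M y -> osum g g y = 0.
  move=> /Mg yg; rewrite -(linmap0 linE); apply: osum_eq => i.
  by rewrite yg inner0l.
have eperp x y : M y -> inner (osum g g x) y = 0.
  by move=> My; rewrite osum_adjoint // e0 // inner0r.
have [|k x|a aE] := @irreducible_scalar (osum g g).
- exact: projection_bounded.
- apply/eqP; rewrite -subr_eq0; apply/eqP/inner_self_eq0.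
  (* [z] lies in the invariant complement [M] and is also orthogonal to [M], hence to itself. *)
  set z := _ - _.
  have Mz : M z.
    rewrite /z.
    have -> : osum g g (U k x) - U k (osum g g x)
            = U k (x - osum g g x) - (U k x - osum g g (U k x)).
      by rewrite (linmapB (spin_linear sU k)) opprB [RHS]addrC addrA subrK.
    by apply: MB => //; apply: MU.
  rewrite {1}/z innerBl eperp // (spin_sa sU) eperp ?subrr //.
  exact: MU.
have ev : osum g g v = v.
  apply/eqP; rewrite eq_sym -subr_eq0; apply/eqP/inner_self_eq0.
  by rewrite innerBr (eM v [::]) innerC eperp // conjC0 subrr.
have a1 : a = 1.
  apply/eqP; rewrite -subr_eq0 -[_ == 0]orbF -(negPf v0) -scaler_eq0.
  by rewrite scalerBl -aE ev scale1r subrr.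
move=> y /word_orbit_perp My.
by rewrite -[y]scale1r -a1 -aE e0.
Qed.

End Irreducible.

Lemma F2_oppr (a : 'F_2) : - a = a.
Proof. by apply/eqP; rewrite -subr_eq0 -opprD F2_addrr oppr0. Qed.

Definition word_vec (w : seq nat) : Z2infty := fun k => (count_mem k w)%:R.

Lemma word_vec_cat w v : word_vec (w ++ v) = word_vec w + word_vec v.
Proof. by apply/funext => k; rewrite /word_vec count_cat natrD. Qed.

Lemma word_vec_nil : word_vec [::] = 0.
Proof. by apply/funext. Qed.

Lemma word_vec_Gamma w : Gamma (word_vec w).
Proof.
apply: (sub_finite_set (B := [set` w])); last exact: finite_seq.
move=> k /=; apply: contra_neqT => kw.
by rewrite /word_vec (count_memPn kw).
Qed.

Lemma GammaP x : Gamma x -> exists w, x = word_vec w.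
Proof.
move=> /finite_seqP[s xs]; exists (undup s); apply/funext => k.
rewrite /word_vec count_uniq_mem ?undup_uniq // mem_undup.
have : (x k != 0) = (k \in s).
  apply/idP/idP => h; first by have : [set` s] k by rewrite -xs.
  by have : [set` s] k by []; rewrite -xs.
by case: (F2P (x k)) => ->; rewrite ?eqxx => <-.
Qed.

Lemma word_vec_sum (F : nat -> 'F_2) w :
  \sum_(k <- undup w) F k * word_vec w k = \sum_(k <- w) F k.
Proof.
rewrite -[RHS]big_undup_iterop_count; apply: eq_bigr => k _.
by rewrite /word_vec mulr_natr.
Qed.

Lemma pairing_word_vec gamma w : pairing gamma (word_vec w) = \sum_(k <- w) gamma k.
Proof.
rewrite -word_vec_sum /pairing -(fsbig_widen [set` undup w]) //=.
  by rewrite -fsbig_seq ?undup_uniq.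
move=> k [_ /= kw]; rewrite /word_vec (count_memPn _) ?mulr0 //.
by apply/negP; rewrite -mem_undup.
Qed.

(** The words come out exchanged because [omega] pairs the first index of [c] with its second
    argument. *)
Lemma omega_word_vec c w v : omega c (word_vec w) (word_vec v) = word_form c v w.
Proof.
rewrite /omega /word_form.
rewrite -(fsbig_widen [set` [seq (i, j) | i <- undup v, j <- undup w]]) //=.
  rewrite -fsbig_seq; last first.
    by apply: allpairs_uniq; rewrite ?undup_uniq // => -[? ?] [? ?].
  rewrite big_allpairs -(word_vec_sum _ v); apply: eq_bigr => i _.
  by rewrite -(word_vec_sum _ w) mulr_suml.
move=> -[i j] [_ /= /negP].
have [jw|jw _] := boolP (j \in w); last first.
  by rewrite /word_vec (count_memPn jw) mulr0 mul0r.
have [iv|iv _] := boolP (i \in v); last first.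
  by rewrite /word_vec (count_memPn iv) mulr0.
by rewrite allpairs_f ?mem_undup.
Qed.

(** * Symplectic reduction of words *)

Lemma ker_omega_word_vec c w :
  (forall i j, c i j = c j i) -> ker_omega c (word_vec w) <-> word_ker c w.
Proof.
move=> c_sym; split=> [[_ kw] k|kw].
  by rewrite (word_formC c_sym) -omega_word_vec kw //; exact: word_vec_Gamma.
split=> [|y /GammaP[v ->]]; first exact: word_vec_Gamma.
by rewrite omega_word_vec (word_formC c_sym) (word_kerP c_sym).
Qed.

Section Symplectic.
Variable c : nat -> nat -> 'F_2.
Hypothesis c_sym : forall i j, c i j = c j i.
Hypothesis c_diag : forall i, c i i = 0.
Local Notation B := (word_form c).
Implicit Types (p q : nat -> seq nat) (w v : seq nat) (f g : nat -> 'F_2).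

Definition word_scale (a : 'F_2) w : seq nat := if a == 0 then [::] else w.

Lemma word_form_scale a w v : B (word_scale a w) v = a * B w v.
Proof.
rewrite /word_scale; case: (F2P a) => ->; first by rewrite word_form_nill mul0r.
by rewrite mul1r.
Qed.

Lemma word_vec_scale a w : word_vec (word_scale a w) = a *: word_vec w.
Proof.
rewrite /word_scale; case: (F2P a) => ->; last by rewrite scale1r.
by rewrite scale0r word_vec_nil.
Qed.

Fixpoint word_comb p q f g (n : nat) : seq nat :=
  if n is m.+1
  then word_scale (f m) (p m) ++ word_scale (g m) (q m) ++ word_comb p q f g m
  else [::].

Definition hyperbolic p q (n : nat) : Prop :=
  forall i j, (i < n)%N -> (j < n)%N ->
    [/\ B (p i) (p j) = 0, B (q i) (q j) = 0 & B (p i) (q j) = (i == j)%:R].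

Lemma word_comb_form p q f g n v :
  B (word_comb p q f g n) v = \sum_(i < n) (f i * B (p i) v + g i * B (q i) v).
Proof.
elim: n => [|n IHn] /=; first by rewrite big_ord0 word_form_nill.
by rewrite big_ord_recr /= !word_form_catl IHn !word_form_scale addrA addrC.
Qed.

Lemma word_comb_p p q f g n j : hyperbolic p q n -> (j < n)%N ->
  B (word_comb p q f g n) (p j) = g j.
Proof.
move=> hpq jn; rewrite word_comb_form (bigD1 (Ordinal jn)) //= big1 => [|i ij].
  have [-> _ _] := hpq j j jn jn.
  have [_ _] := hpq j j jn jn; rewrite eqxx (word_formC c_sym) => ->.
  by rewrite mulr0 mulr1 add0r addr0.
have [-> _ _] := hpq i j (ltn_ord i) jn.
have [_ _] := hpq j i jn (ltn_ord i); rewrite (word_formC c_sym) => ->.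
rewrite eq_sym (_ : (i : nat) == j = false) ?mulr0 ?addr0 //.
exact: negPf ij.
Qed.

Lemma word_comb_q p q f g n j : hyperbolic p q n -> (j < n)%N ->
  B (word_comb p q f g n) (q j) = f j.
Proof.
move=> hpq jn; rewrite word_comb_form (bigD1 (Ordinal jn)) //= big1 => [|i ij].
  have [_ -> ->] := hpq j j jn jn.
  by rewrite eqxx mulr0 mulr1 !addr0.
have [_ -> ->] := hpq i j (ltn_ord i) jn.
rewrite (_ : (i : nat) == j = false) ?mulr0 ?addr0 //.
exact: negPf ij.
Qed.

Lemma word_comb_vec p q f g n :
  word_vec (word_comb p q f g n) =
    \sum_(i < n) (f i *: word_vec (p i) + g i *: word_vec (q i)).
Proof.
elim: n => [|n IHn] /=; first by rewrite big_ord0 word_vec_nil.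
by rewrite big_ord_recr /= !word_vec_cat IHn !word_vec_scale addrA addrC.
Qed.

(** The component of [w] orthogonal to the first [n] pairs. The coefficient along [p i] is read by
    pairing with [q i], and conversely; in characteristic 2, concatenation also subtracts. *)
Definition word_red p q (n : nat) w : seq nat :=
  w ++ word_comb p q (fun i => B w (q i)) (fun i => B w (p i)) n.

Lemma word_red_p p q n w j : hyperbolic p q n -> (j < n)%N ->
  B (word_red p q n w) (p j) = 0.
Proof. by move=> h jn; rewrite word_form_catl word_comb_p // F2_addrr. Qed.

Lemma word_red_q p q n w j : hyperbolic p q n -> (j < n)%N ->
  B (word_red p q n w) (q j) = 0.
Proof. by move=> h jn; rewrite word_form_catl word_comb_q // F2_addrr. Qed.

Lemma word_red_form p q n w v :
  (forall j, (j < n)%N -> B v (p j) = 0) ->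
  (forall j, (j < n)%N -> B v (q j) = 0) ->
  B (word_red p q n w) v = B w v.
Proof.
move=> vp vq; rewrite word_form_catl word_comb_form big1 ?addr0 // => i _.
by rewrite !(word_formC c_sym _ v) vp ?vq ?mulr0 ?addr0.
Qed.

Lemma word_comb_eq p q p' q' f g f' g' n :
  (forall i, (i < n)%N -> [/\ p i = p' i, q i = q' i, f i = f' i & g i = g' i]) ->
  word_comb p q f g n = word_comb p' q' f' g' n.
Proof.
elim: n => //= n IHn h; have [-> -> -> ->] := h n (ltnSn n).
by rewrite IHn // => i lt_in; apply/h/ltnW.
Qed.

Lemma word_red_eq p q p' q' n w :
  (forall i, (i < n)%N -> p i = p' i /\ q i = q' i) ->
  word_red p q n w = word_red p' q' n w.
Proof.
move=> h; congr (_ ++ _); apply: word_comb_eq => i lt_in.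
by have [-> ->] := h i lt_in.
Qed.

Lemma word_redS p q n w : word_form c w (p n) = 0 -> word_form c w (q n) = 0 ->
  word_red p q n.+1 w = word_red p q n w.
Proof. by rewrite /word_red /= => -> ->; rewrite /word_scale eqxx. Qed.

(** If the reduction is in the radical, [w] pairs to zero with all that is orthogonal to the first
    [n] pairs, so with [p n] and [q n]: the next stage appends nothing. *)
Lemma word_red_kerS p q n w : hyperbolic p q n.+1 ->
  word_ker c (word_red p q n w) -> word_ker c (word_red p q n.+1 w).
Proof.
move=> hpq kw.
have pn j : (j < n)%N -> B (p n) (p j) = 0 /\ B (p n) (q j) = 0.
  move=> jn; have [-> _ ->] := hpq n j (ltnSn n) (ltnW jn).
  by rewrite gtn_eqF.
have qn j : (j < n)%N -> B (q n) (p j) = 0 /\ B (q n) (q j) = 0.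
  move=> jn; have [_ -> _] := hpq n j (ltnSn n) (ltnW jn).
  have [_ _] := hpq j n (ltnW jn) (ltnSn n).
  by rewrite (word_formC c_sym) ltn_eqF.
rewrite word_redS //.
- rewrite -(@word_red_form p q n); first exact: (word_kerP c_sym).
    by move=> j /pn[].
  by move=> j /pn[].
- rewrite -(@word_red_form p q n); first exact: (word_kerP c_sym).
    by move=> j /qn[].
  by move=> j /qn[].
Qed.

Lemma word_red_ker_le p q n m w : (n <= m)%N -> hyperbolic p q m ->
  word_ker c (word_red p q n w) -> word_ker c (word_red p q m w).
Proof.
move=> nm; rewrite -(subnKC nm); elim: (m - n)%N => [|k IHk]; first by rewrite addn0.
rewrite addnS => h kw; apply: word_red_kerS => //; apply: IHk => //.
by move=> i j ik jk; apply: h; rewrite ltnS ltnW.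
Qed.

Definition upd (T : Type) (h : nat -> T) (n : nat) (a : T) (i : nat) : T :=
  if i == n then a else h i.

Lemma hyperbolic_extend p q n w :
  hyperbolic p q n -> ~ word_ker c (word_red p q n w) ->
  exists a b, hyperbolic (upd p n a) (upd q n b) n.+1 /\
    word_ker c (word_red (upd p n a) (upd q n b) n.+1 w).
Proof.
move=> hpq /existsNP[k kw].
(* The new pair consists of the reduction of [w] and that of a generator which detects it. *)
pose a := word_red p q n w; pose b := word_red p q n [:: k].
have ak : B a [:: k] = 1 by case: (F2P (B a [:: k])) => // /kw.
have ap j : (j < n)%N -> B a (p j) = 0 by move=> jn; apply: word_red_p.
have aq j : (j < n)%N -> B a (q j) = 0 by move=> jn; apply: word_red_q.
have bp j : (j < n)%N -> B b (p j) = 0 by move=> jn; apply: word_red_p.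
have bq j : (j < n)%N -> B b (q j) = 0 by move=> jn; apply: word_red_q.
have ab : B a b = 1.
  by rewrite (word_formC c_sym) word_red_form // (word_formC c_sym).
have updE (T : Type) (h : nat -> T) x i : (i < n)%N -> upd h n x i = h i.
  by rewrite /upd => /ltn_eqF ->.
have updn (T : Type) (h : nat -> T) x : upd h n x n = x by rewrite /upd eqxx.
exists a, b; split.
  move=> i j; rewrite !ltnS (leq_eqVlt i) (leq_eqVlt j).
  case/orP=> [/eqP->|lt_in]; case/orP=> [/eqP->|lt_jn]; rewrite ?updn ?updE //.
  - by rewrite !(word_form_self c_sym c_diag) ab eqxx.
  - by rewrite ap // aq // bq // gtn_eqF.
  - rewrite ![B (p i) _](word_formC c_sym) ![B (q i) _](word_formC c_sym).
    by rewrite ap // bp // bq // ltn_eqF.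
  - exact: hpq.
have redE : w ++ word_comb (upd p n a) (upd q n b) (fun i => B w (upd q n b i))
    (fun i => B w (upd p n a i)) n = a.
  by apply: (word_red_eq (p := upd p n a)) => i lt_in; rewrite !updE.
(* As [w] pairs to 0 with [a] and to 1 with [b], stage [n] appends [a] to the old reduction, which
   is [a] itself; the two copies cancel. *)
have wa : B w a = 0.
  by rewrite -(@word_red_form p q n) ?(word_form_self c_sym c_diag).
have wb : B w b = 1 by rewrite -(@word_red_form p q n).
rewrite /word_red /= !updn wa wb => v.
rewrite !word_form_catl /word_scale /= word_form_nill add0r addrCA -word_form_catl.
by rewrite -word_form_catl redE F2_addrr.
Qed.

Hypothesis c_rank : infinite_rank c.

(** Otherwise the [2n] words would be a basis of [Gamma] modulo the radical, against infinite rank;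
    coefficients are unique because pairing with the dual word recovers them. *)
Lemma hyperbolic_incomplete p q n : hyperbolic p q n ->
  exists w, ~ word_ker c (word_red p q n w).
Proof.
move=> hpq; apply/existsNP => hk; apply: (c_rank (d := (n + n)%N)).
pose b (i : 'I_(n + n)) : Z2infty :=
  match fintype.split i with inl j => word_vec (p j) | inr j => word_vec (q j) end.
have sumE (a : {ffun 'I_(n + n) -> 'F_2}) f g :
    (forall i : 'I_n, a (lshift n i) = f i) ->
    (forall i : 'I_n, a (rshift n i) = g i) ->
    \sum_i a i *: b i = word_vec (word_comb p q f g n).
  move=> fE gE; rewrite word_comb_vec big_split_ord big_split /=.
  congr (_ + _); apply: eq_bigr => i _.
    by rewrite fE /b (unsplitK (inl i)).
  by rewrite gE /b (unsplitK (inr i)).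
exists b; split=> [i|x /GammaP[w ->]].
  by rewrite /b; case: fintype.split => j; exact: word_vec_Gamma.
have NE v : - word_vec v = word_vec v.
  by apply/funext => k; exact: F2_oppr.
pose f i := B w (q i); pose g i := B w (p i).
exists [ffun i : 'I_(n + n) => match fintype.split i with inl j => f j | inr j => g j end].
split.
  rewrite (sumE _ f g) => [|i|i]; last 2 first.
  - by rewrite ffunE (unsplitK (inl i)).
  - by rewrite ffunE (unsplitK (inr i)).
  rewrite NE -word_vec_cat; apply/(ker_omega_word_vec _ c_sym)/hk.
move=> a; pose f' i := if insub i is Some j then a (lshift n j) else 0.
pose g' i := if insub i is Some j then a (rshift n j) else 0.
rewrite (sumE _ f' g') => [|i|i]; last 2 first.
- by rewrite /f' valK.
- by rewrite /g' valK.
rewrite NE -word_vec_cat => /(ker_omega_word_vec _ c_sym) kw.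
apply/ffunP => i; rewrite ffunE -[i in a i]splitK; case: (fintype.split i) => j /=.
  have := word_kerP c_sym (q j) kw; rewrite word_form_catl word_comb_q //.
  by rewrite /f' valK => /eqP; rewrite addr_eq0 F2_oppr => /eqP.
have := word_kerP c_sym (p j) kw; rewrite word_form_catl word_comb_p //.
by rewrite /g' valK => /eqP; rewrite addr_eq0 F2_oppr => /eqP.
Qed.

(** Strict growth keeps the sequence infinite: when [w] is already exhausted, some other word
    supplies the new pair. *)
Lemma hyperbolic_step p q n w : hyperbolic p q n ->
  exists a b m, [/\ (n < m)%N, hyperbolic a b m,
    forall i, (i < n)%N -> a i = p i /\ b i = q i &
    word_ker c (word_red a b m w)].
Proof.
have agree a b i : (i < n)%N -> upd p n a i = p i /\ upd q n b i = q i.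
  by move=> lt_in; rewrite /upd ltn_eqF.
move=> hpq; have [kw|/(hyperbolic_extend hpq)[a [b [hab kw]]]] :=
    pselect (word_ker c (word_red p q n w)); last first.
  by exists (upd p n a), (upd q n b), n.+1; split=> // i; apply: agree.
have [v /(hyperbolic_extend hpq)[a [b [hab _]]]] := hyperbolic_incomplete hpq.
exists (upd p n a), (upd q n b), n.+1; split=> // [i|]; first exact: agree.
apply: word_red_kerS => //; rewrite (@word_red_eq _ _ p q) //.
by move=> i; exact: agree.
Qed.

Lemma symplectic_sequence : exists p q,
  (forall n, hyperbolic p q n) /\
  forall k, exists n, forall m, (n <= m)%N -> word_ker c (word_red p q m [:: k]).
Proof.
pose state := ((nat -> seq nat) * (nat -> seq nat) * nat)%type.
pose inv (s : state) := hyperbolic s.1.1 s.1.2 s.2.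
(* Assuming [inv] inside the relation gives every state a successor, so that choice applies; the
   step from stage [k] exhausts the generator [k]. *)
pose next (sk : state * nat) (s' : state) := inv sk.1 ->
  [/\ (sk.1.2 < s'.2)%N, inv s',
    forall i, (i < sk.1.2)%N -> s'.1.1 i = sk.1.1.1 i /\ s'.1.2 i = sk.1.1.2 i &
    word_ker c (word_red s'.1.1 s'.1.2 s'.2 [:: sk.2])].
have [F FP] : {F & forall sk, next sk (F sk)}.
  apply: choice => -[[[p q] n] k].
  have [hpq|nh] := pselect (hyperbolic p q n); last by exists (p, q, n).
  have [a [b [m [nm hab agree kw]]]] := hyperbolic_step [:: k] hpq.
  by exists (a, b, m).
pose s := fix s k := if k is l.+1 then F (s l, l) else ((fun=> [::]), (fun=> [::]), 0%N).
have sI k : inv (s k) by elim: k => [//|k IHk]; have [] := FP (s k, k) IHk.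
have sS k := FP (s k, k) (sI k).
have s_ge k : (k <= (s k).2)%N.
  by elim: k => // k IHk; have [lt_k _ _ _] := sS k; apply: leq_ltn_trans lt_k.
have s_mono k l : (k <= l)%N -> ((s k).2 <= (s l).2)%N.
  move=> kl; rewrite -(subnKC kl); elim: (l - k)%N => [|d IHd]; first by rewrite addn0.
  by rewrite addnS; have [/ltnW h _ _ _] := sS (k + d)%N; apply: leq_trans h.
have s_agree k l i : (k <= l)%N -> (i < (s k).2)%N ->
    (s l).1.1 i = (s k).1.1 i /\ (s l).1.2 i = (s k).1.2 i.
  move=> kl ik; rewrite -(subnKC kl); elim: (l - k)%N => [|d IHd]; first by rewrite addn0.
  rewrite addnS; have [_ _ h _] := sS (k + d)%N.
  have [|-> ->] := h i; first by apply: (leq_trans ik); apply: s_mono; apply: leq_addr.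
  exact: IHd.
(* Stage [i + 1] has length greater than [i], and later stages keep its entries, so the diagonal
   agrees with every stage. *)
pose p i := (s i.+1).1.1 i; pose q i := (s i.+1).1.2 i.
have pqE k i : (i < (s k).2)%N -> p i = (s k).1.1 i /\ q i = (s k).1.2 i.
  move=> ik; have ii : (i < (s i.+1).2)%N := s_ge i.+1.
  have [ki|/ltnW ki] := leqP k i.+1.
    by have [h1 h2] := s_agree k i.+1 i ki ik; rewrite /p /q h1 h2.
  by have [h1 h2] := s_agree i.+1 k i ki ii; rewrite /p /q h1 h2.
have hpq n : hyperbolic p q n.
  move=> i j lt_in lt_jn.
  have [-> ->] := pqE n i (leq_trans lt_in (s_ge n)).
  have [-> ->] := pqE n j (leq_trans lt_jn (s_ge n)).
  by apply: sI; apply: leq_trans (s_ge n).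
exists p, q; split=> // k; exists (s k.+1).2 => m le_m.
apply: (word_red_ker_le le_m) => //; have [_ _ _ kw] := sS k.
by rewrite (word_red_eq (p' := (s k.+1).1.1) (q' := (s k.+1).1.2)) // => i; exact: pqE.
Qed.

End Symplectic.

(** * Equivalence and the scalars of the radical *)

Section Intertwining.
Context {R : realType}.
Local Notation C := R[i].
Variable c : nat -> nat -> 'F_2.
Hypothesis c_sym : forall i j, c i j = c j i.
Hypothesis c_diag : forall i, c i i = 0.

Lemma herm_wordop_pauli (H : hilbertType R) (U : nat -> H -> H)
    (p q : nat -> seq nat) :
  spin_system c U -> (forall n, hyperbolic c p q n) ->
  pauli_system (fun i => herm_wordop c U (p i)) (fun i => herm_wordop c U (q i)).
Proof.
move=> sU hpq.
have h i j := hpq (maxn i j).+1 i j (leq_maxl i j) (leq_maxr i j).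
split=> [i|i|i|i|i|i|i j x|i j x|i j x].
- exact: herm_wordop_linear.
- exact: herm_wordop_linear.
- exact: (herm_wordop_sa c_sym).
- exact: (herm_wordop_sa c_sym).
- exact: (herm_wordopK c_sym).
- exact: (herm_wordopK c_sym).
- have [pp _ _] := h i j.
  by rewrite (herm_wordop_comm c_sym sU) pp scale1r.
- have [_ qq _] := h i j.
  by rewrite (herm_wordop_comm c_sym sU) qq scale1r.
- have [_ _ pq] := h i j.
  rewrite (herm_wordop_comm c_sym sU) pq; congr (_ *: _).
  by case: eqP.
Qed.

Definition same_scalars (H K : hilbertType R) (U : nat -> H -> H)
    (V : nat -> K -> K) : Prop :=
  forall w, word_ker c w -> forall a : C,
    (forall x, wordop U w x = a *: x) -> forall y, wordop V w y = a *: y.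

Hypothesis c_rank : infinite_rank c.

Lemma exact_intertwiner (H K : hilbertType R) (U : nat -> H -> H)
    (V : nat -> K -> K) :
  irreducible_spin_system c U -> irreducible_spin_system c V ->
  same_scalars U V ->
  forall n, exists W : H -> K, unitary W /\
    forall k, (k < n)%N -> forall x, W (U k x) = V k (W x).
Proof.
move=> iU iV UV n; have [sU sV] := (iU.1, iV.1).
have [p [q [hpq redk]]] := symplectic_sequence c_sym c_diag c_rank.
have [m redm] : exists m, forall k, (k < n)%N ->
    word_ker c (word_red c p q m [:: k]).
  elim: n => [|n [m IHm]]; first by exists 0%N.
  have [l lP] := redk n; exists (maxn l m) => k.
  rewrite ltnS leq_eqVlt => /orP[/eqP->|/IHm h].
    by apply: lP; apply: leq_maxl.
  by apply: (word_red_ker_le c_sym (leq_maxr l m)).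
have [[v v0] _ _ _] := sU; have [[v' v'0] _ _ _] := sV.
have [W [uW WPQ]] := pauli_intertwine (herm_wordop_pauli sU hpq)
  (herm_wordop_pauli sV hpq) (ex_intro _ v v0) (ex_intro _ v' v'0)
  (irreducible_cyclic iU v0) (irreducible_cyclic iV v'0) m.
have lW : linear W by case: uW => -[].
exists W; split=> // k /redm kw x.
(* The phase depends on [c] and [w] only, so it is the same on both sides and cancels. *)
have Wherm w : (forall x, W (herm_wordop c U w x) = herm_wordop c V w (W x)) ->
    forall x, W (wordop U w x) = wordop V w (W x).
  move=> h y; apply: (scalerI (word_phase_neq0 c w)).
  by rewrite -(linmapZ lW) h.
have Wcomb f g l : (l <= m)%N -> forall x,
    W (wordop U (word_comb p q f g l) x) = wordop V (word_comb p q f g l) (W x).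
  elim: l => [//|l IHl] lm y /=; rewrite !wordop_cat.
  have [hP hQ] := WPQ l lm.
  have Wscale a w : (forall x, W (wordop U w x) = wordop V w (W x)) ->
      forall x, W (wordop U (word_scale a w) x) = wordop V (word_scale a w) (W x).
    by rewrite /word_scale; case: (a == 0).
  by rewrite !Wscale ?IHl 1?ltnW //; apply: Wherm.
have [a aP] := irreducible_ker c_sym iU kw.
have bP := UV _ kw a aP.
(* The letter [k] followed by [w] is the reduction of [k] and acts as the scalar [a] in both
   systems, so [w] determines [U k] and [V k] in the same way. *)
pose w := word_comb p q (fun i => word_form c [:: k] (q i))
  (fun i => word_form c [:: k] (p i)) m.
have Uk y : U k (wordop U w y) = a *: y by rewrite -aP /word_red wordop_cat.
have Vk y : V k (wordop V w y) = a *: y by rewrite -bP /word_red wordop_cat.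
rewrite -[x](wordopK_rev sU w) Uk (linmapZ lW) -Vk; congr (V k _).
by rewrite -Wcomb // (wordopK_rev sU).
Qed.

End Intertwining.

Section Equivalence.
Context {R : realType}.
Local Notation C := R[i].

Lemma unitary_linear (H K : hilbertType R) (W : H -> K) : unitary W -> linear W.
Proof. by case=> -[]. Qed.

Lemma unitary_norm (H K : hilbertType R) (W : H -> K) x :
  unitary W -> `|W x| = `|x|.
Proof.
by case=> _ [W' [_ adj WK _]]; apply: isometry_norm; rewrite adj WK.
Qed.

Lemma opnorm0 (H K : hilbertType R) (T : H -> K) :
  (forall x, T x = 0) -> opnorm T = 0%E.
Proof.
move=> T0; rewrite /opnorm (_ : [set _ | _ in _] = [set 0%E]) ?ereal_sup1 //.
apply/seteqP; split=> [_ [x _ <-]|_ ->] /=; first by rewrite T0 normr0.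
by exists 0; rewrite ?T0 ?normr0 //= ler01.
Qed.

Lemma opnorm_lt (H K : hilbertType R) (T : H -> K) (r : R) x :
  (opnorm T < r%:E)%E -> `|x| <= 1 -> `|T x| < r%:C%C.
Proof.
move=> Tr x1.
have : ((complex.Re `|T x|)%:E <= opnorm T)%E by apply: ereal_sup_ubound; exists x.
move=> /le_lt_trans/(_ Tr); rewrite lte_fin -ltcR RRe_real //.
Qed.

Variable c : nat -> nat -> 'F_2.
Hypothesis c_sym : forall i j, c i j = c j i.
Hypothesis c_diag : forall i, c i i = 0.
Hypothesis c_rank : infinite_rank c.

Lemma same_scalars_equiv (H K : hilbertType R) (U : nat -> H -> H)
    (V : nat -> K -> K) :
  irreducible_spin_system c U -> irreducible_spin_system c V ->
  same_scalars c U V -> spin_equiv U V.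
Proof.
move=> iU iV UV.
have /choice[W WP] := exact_intertwiner c_sym c_diag c_rank iU iV UV.
have /choice[W' W'P] : forall n, exists W', cancel (W n) W' /\ cancel W' (W n).
  by move=> n; have [[_ [W' [_ _ WK W'K]]] _] := WP n; exists W'.
exists W, W'; split=> [n|k]; first by have [? ?] := W'P n; have [? _] := WP n.
(* The difference vanishes identically from rank [k + 1] on. *)
apply: cvg_near_cst; exists k.+1 => // n /= lt_kn; apply: opnorm0 => y.
by have [_ ->] := WP n; rewrite // (W'P n).2 subrr.
Qed.

Lemma equiv_same_scalars (H K : hilbertType R) (U : nat -> H -> H)
    (V : nat -> K -> K) :
  irreducible_spin_system c U -> irreducible_spin_system c V ->
  spin_equiv U V -> same_scalars c U V.
Proof.
move=> iU iV [W [W' [WW' Wlim]]] w kw a aP.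
have [sU sV] := (iU.1, iV.1).
have [b bP] := irreducible_ker c_sym iV kw.
have uW n : unitary (W n) by have [] := WW' n.
have W'K n : cancel (W' n) (W n) by have [] := WW' n.
have lW n := unitary_linear (uW n).
have uU k : unitary (U k) by have [_ _ ? _] := sU.
(* Convergence on generators extends to words. Uniformity on the unit ball matters: the bound for
   the letter [k] is applied to the vector [wordop V u y]. *)
have close u (r : R) : 0 < r -> exists N, forall n, (N <= n)%N ->
    forall y, `|y| <= 1 ->
      `|W n (wordop U u (W' n y)) - wordop V u y| < r%:C%C.
  elim: u r => [|k u IHu] r r0 /=.
    by exists 0%N => n _ y _; rewrite W'K subrr normr0 ltcR.
  have r20 : 0 < r / 2 by rewrite divr_gt0.
  have [N NP] := IHu _ r20.
  have [M _ MP] : \forall n \near \oo,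
      (opnorm (fun y => (W n (U k (W' n y)) - V k y)%R) < (r / 2)%:E)%E.
    by apply: (Wlim k [set z | (z < (r / 2)%:E)%E]); apply: open_ereal_lt'; rewrite lte_fin.
  exists (maxn N M) => n; rewrite geq_max => /andP[Nn Mn] y y1.
  pose z := W n (wordop U u (W' n y)).
  have Vy1 : `|wordop V u y| <= 1.
    rewrite (isometry_norm (T := wordop V u)) //.
    by rewrite (wordop_adjoint sV) (wordop_revK sV).
  have := opnorm_lt (MP n Mn) Vy1; have := NP n Nn y y1; rewrite -/z.
  move=> h1 h2; rewrite [in r%:C%C](splitr r) rmorphD /=.
  apply: le_lt_trans (ltrD h1 h2).
  set v := wordop V u y.
  have -> : W n (U k (wordop U u (W' n y))) - V k v =
      W n (U k (W' n z - W' n v)) + (W n (U k (W' n v)) - V k v).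
    rewrite (linmapB (spin_linear sU k)) (linmapB (lW n)) addrA subrK.
    by rewrite /z; have [_ -> _] := WW' n.
  apply: (le_trans (ler_normD _ _)); rewrite lerD2r.
  (* Of [W' n] it is only given that it inverts [W n], so the distance between its values is
     measured after applying [W n]. *)
  rewrite (unitary_norm _ (uW n)) (unitary_norm _ (uU k)).
  by rewrite -(unitary_norm (W' n z - W' n v) (uW n)) (linmapB (lW n)) !W'K.
suff -> : a = b by [].
have [[v v0] _ _ _] := sV.
pose y : _ := `|v|^-1 *: v.
have y1 : `|y| = 1 by rewrite normrZ normfV normr_id mulVf ?normr_eq0.
apply/eqP; rewrite -subr_eq0 -normr_eq0; apply: contraT => ab0.
have ab_real : (complex.Re `|a - b|)%:C%C = `|a - b| by rewrite RRe_real.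
(* At this tolerance the unit vector [y] gives [|a - b| < |a - b|]. *)
have [|N NP] := close w (complex.Re `|a - b|).
  by rewrite -ltcR ab_real lt_def ab0 normr_ge0.
have := NP N (leqnn N) y; rewrite y1 ab_real => /(_ (lexx _)).
rewrite aP (linmapZ (lW N)) W'K bP -scalerBl normrZ y1 mulr1.
by rewrite ltxx.
Qed.

Lemma wordop_twist (H : hilbertType R) (U : nat -> H -> H) (gamma : Z2infty) w x :
  spin_system c U ->
  wordop (twist gamma U) w x = sign2 (\sum_(k <- w) gamma k) *: wordop U w x.
Proof.
move=> sU; elim: w => [|k w IHw] /=; first by rewrite big_nil scale1r.
by rewrite IHw /twist (linmapZ (spin_linear sU k)) scalerA big_cons sign2D.
Qed.

Lemma twist_irreducible (H : hilbertType R) (U : nat -> H -> H) (gamma : Z2infty) :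
  irreducible_spin_system c U -> irreducible_spin_system c (twist gamma U).
Proof.
move=> [sU iU]; have [nz sa uU cU] := sU.
have linU k := spin_linear sU k.
split; first split=> //.
- by move=> k x y; rewrite /twist innerZl innerZr sa sign2_conj.
- move=> k; apply: (@adjoint_unitary _ _ _ _ (twist gamma U k)).
  + move=> a x y; rewrite /twist linU scalerDr !scalerA mulrC //.
  + move=> a x y; rewrite /twist linU scalerDr !scalerA mulrC //.
  + by move=> x y; rewrite /twist innerZl innerZr sa sign2_conj.
  + move=> x; rewrite /twist (linmapZ (linU k)) (spinK sU) scalerA sign2K.
    by rewrite scale1r.
  + move=> x; rewrite /twist (linmapZ (linU k)) (spinK sU) scalerA sign2K.
    by rewrite scale1r.
- move=> i j x; rewrite /twist (linmapZ (linU i)) (linmapZ (linU j)) cU !scalerA.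
  by congr (_ *: _); ring.
rewrite /irreducible_set -iU; apply/seteqP; split=> T [bT cT]; split=> //.
- move=> _ [k _ <-]; apply/funext => x /=.
  have := cT (twist gamma U k); move=> /(_ (ex_intro2 _ _ k I erefl)).
  move=> /(congr1 (fun f => f x)); rewrite /= /twist (linmapZ bT.1).
  exact: (scalerI (sign2_neq0 _)).
- move=> _ [k _ <-]; apply/funext => x /=.
  have := cT (U k); move=> /(_ (ex_intro2 _ _ k I erefl)).
  by move=> /(congr1 (fun f => f x)) /= h; rewrite /twist (linmapZ bT.1) h.
Qed.

Lemma twist_equivP (H : hilbertType R) (U : nat -> H -> H) (gamma gamma' : Z2infty) :
  irreducible_spin_system c U ->
  spin_equiv (twist gamma U) (twist gamma' U) <->
  (forall x, ker_omega c x -> pairing gamma x = pairing gamma' x).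
Proof.
move=> iU; have sU := iU.1.
have [[v v0] _ _ _] := sU.
have i1 := twist_irreducible gamma iU; have i2 := twist_irreducible gamma' iU.
split=> [/(equiv_same_scalars i1 i2) h x kx|h].
  have [w xw] := GammaP kx.1; rewrite {x}xw in kx *.
  have kw := (ker_omega_word_vec w c_sym).1 kx.
  have [a aP] := irreducible_ker c_sym iU kw.
  have a0 : a != 0.
    apply: contraNneq v0 => a0; rewrite -(wordop_revK sU w v) aP a0 scale0r.
    by rewrite (linmap0 (wordop_linear sU _)).
  rewrite !pairing_word_vec.
  have := h w kw (sign2 (\sum_(k <- w) gamma k) * a).
  have tw x : wordop (twist gamma U) w x = (sign2 (\sum_(k <- w) gamma k) * a) *: x.
    by rewrite wordop_twist // aP scalerA.
  move=> /(_ tw v); rewrite wordop_twist // aP scalerA => /eqP.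
  rewrite -subr_eq0 -scalerBl scaler_eq0 (negPf v0) orbF subr_eq0.
  by rewrite (inj_eq (mulIf a0)) => /eqP/sign2_inj ->.
apply: (same_scalars_equiv i1 i2) => w kw a aP y.
rewrite wordop_twist // -!pairing_word_vec -h ?pairing_word_vec.
  by rewrite -wordop_twist.
exact/(ker_omega_word_vec w c_sym).
Qed.

End Equivalence.

(** * Extension of functionals from the radical *)

Lemma pairingD gamma x y : Gamma x -> Gamma y ->
  pairing gamma (x + y) = pairing gamma x + pairing gamma y.
Proof.
move=> /GammaP[w ->] /GammaP[v ->].
by rewrite -word_vec_cat !pairing_word_vec big_cat.
Qed.

Lemma GammaD x y : Gamma x -> Gamma y -> Gamma (x + y).
Proof.
move=> /GammaP[w ->] /GammaP[v ->]; rewrite -word_vec_cat.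
exact: word_vec_Gamma.
Qed.

Definition below (n : nat) (x : Z2infty) : Prop :=
  forall k, (n <= k)%N -> x k = 0.

Lemma Gamma_below x : Gamma x -> exists n, below n x.
Proof.
move=> /GammaP[w ->]; exists (\max_(k <- w) k).+1 => k lt_k.
rewrite /word_vec (count_memPn _) //; apply/negP => kw.
by have := @leq_bigmax_seq nat w xpredT id k kw isT; rewrite leqNgt lt_k.
Qed.

Lemma pairing_below gamma n x : below n x ->
  pairing gamma x = \sum_(0 <= k < n) gamma k * x k.
Proof.
move=> xn; rewrite /pairing -(fsbig_widen [set` index_iota 0 n]) //=.
  by rewrite -fsbig_seq ?iota_uniq.
move=> k [_ /= kn]; rewrite xn ?mulr0 // leqNgt; apply/negP => lt_kn.
by apply: kn; rewrite mem_index_iota.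
Qed.

Section Pivots.
Variable N : set Z2infty.
Hypothesis N_Gamma : N `<=` Gamma.
Hypothesis ND : forall x y, N x -> N y -> N (x + y).

Definition leads (x : Z2infty) (j : nat) : Prop := x j = 1 /\ below j.+1 x.

(** An echelon form read from the last coordinates: [below n] then filters [N] by finitely many
    coordinates, which supports induction on [n]. *)
Definition pivot (j : nat) : Prop := exists2 x, N x & leads x j.

(** Pairing with an element led by [j] determines the value at [j] from those at smaller indices. *)
Lemma pivot_unique (gamma gamma' : Z2infty) :
  (forall j, ~ pivot j -> gamma j = 0) ->
  (forall j, ~ pivot j -> gamma' j = 0) ->
  (forall x, N x -> pairing gamma x = pairing gamma' x) -> gamma = gamma'.
Proof.
move=> g0 g'0 gg'; apply/funext; elim/ltn_ind => j IHj.
have [[z Nz [zj jz]]|nj] := pselect (pivot j); last by rewrite g0 ?g'0.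
have := gg' z Nz; rewrite !(pairing_below _ jz) !big_nat_recr //= zj !mulr1.
rewrite (eq_big_nat _ _ (F2 := fun k => gamma' k * z k)) => [/addrI//|k kj].
by rewrite IHj.
Qed.

Section Extension.
Variable f : Z2infty -> 'F_2.
Hypothesis fD : forall x y, N x -> N y -> f (x + y) = f x + f y.
Variable z : nat -> Z2infty.
Hypothesis zP : forall j, pivot j -> N (z j) /\ leads (z j) j.

(** At a pivot [n], the pairing with [z n] forces the value once the earlier ones, stored in [s],
    are known. *)
Definition ext_val (s : seq 'F_2) (n : nat) : 'F_2 :=
  if `[< pivot n >] then f (z n) - \sum_(0 <= k < n) nth 0 s k * z n k else 0.

Fixpoint ext_seq (n : nat) : seq 'F_2 :=
  if n is m.+1 then rcons (ext_seq m) (ext_val (ext_seq m) m) else [::].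

Definition extension : Z2infty := fun n => ext_val (ext_seq n) n.

Lemma nth_ext_seq n k : (k < n)%N -> nth 0 (ext_seq n) k = extension k.
Proof.
have size_ext m : size (ext_seq m) = m by elim: m => //= m; rewrite size_rcons => ->.
elim: n => // n IHn; rewrite ltnS leq_eqVlt /= nth_rcons size_ext.
by case: (ltngtP k n) => //= [lt_kn _|->]; first exact: IHn.
Qed.

Lemma extension_pairing x : N x -> pairing extension x = f x.
Proof.
move=> Nx; have [n xn] := Gamma_below (N_Gamma Nx).
have F2x (y : Z2infty) : y + y = 0 by apply/funext => k; exact: F2_addrr.
elim: n x Nx xn => [|n IHn] x Nx xn.
  have x0 : x = 0 by apply/funext => k; rewrite xn.
  rewrite (pairing_below _ xn) big_geq //.
  by apply: (addrI (f x)); rewrite -fD // F2x -x0 addr0.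
have [xn0|xn1] := F2P (x n).
  apply: IHn => // k; rewrite leq_eqVlt => /orP[/eqP<-//|]; exact: xn.
have pn : pivot n by exists x.
have [Nz [zn nz]] := zP pn.
have pz : pairing extension (z n) = f (z n).
  rewrite (pairing_below _ nz) big_nat_recr //= zn mulr1 {2}/extension /ext_val.
  rewrite asboolT // [X in _ - X](eq_big_nat _ _ (F2 := fun k => extension k * z n k)).
    by rewrite addrC subrK.
  by move=> k /= kn; rewrite nth_ext_seq.
(* Adding [z n] cancels the last coordinate of [x], so the induction hypothesis applies. *)
have : pairing extension (x + z n) = f (x + z n).
  apply: IHn; first exact: ND.
  move=> k; rewrite leq_eqVlt => /orP[/eqP<-|nk].
    by rewrite -[LHS]/(x n + z n n) xn1 zn F2_addrr.
  by rewrite -[LHS]/(x k + z n k) xn // nz // addr0.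
rewrite pairingD ?fD //; try exact: N_Gamma.
by rewrite pz => /addIr.
Qed.

End Extension.

Lemma pivot_extension (f : Z2infty -> 'F_2) :
  (forall x y, N x -> N y -> f (x + y) = f x + f y) ->
  exists2 gamma : Z2infty, (forall j, ~ pivot j -> gamma j = 0) &
    forall x, N x -> pairing gamma x = f x.
Proof.
move=> fD; have [z zP] : {z : nat -> Z2infty &
    forall j, pivot j -> N (z j) /\ leads (z j) j}.
  pose P j x := pivot j -> N x /\ leads x j.
  apply: (@choice _ _ P) => j; have [[x Nx lx]|nj] := pselect (pivot j); last by exists 0.
  by exists x => _.
exists (extension f z) => [j nj|x]; last exact: extension_pairing.
by rewrite /extension /ext_val asboolF.
Qed.

End Pivots.

Lemma ker_omegaD c : (forall i j, c i j = c j i) ->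
  forall x y, ker_omega c x -> ker_omega c y -> ker_omega c (x + y).
Proof.
move=> c_sym x y kx ky; have [w xw] := GammaP kx.1; have [v yv] := GammaP ky.1.
rewrite {}xw {}yv in kx ky *; rewrite -word_vec_cat.
move: kx ky; rewrite !(ker_omega_word_vec _ c_sym); exact: word_ker_cat.
Qed.

Lemma natr_F2 n : n%:R = (odd n)%:R :> 'F_2.
Proof.
elim: n => // n IHn; rewrite mulrSr IHn /=.
by case: (odd n); apply/val_inj.
Qed.

Lemma word_vec_odd w v k : word_vec w = word_vec v ->
  odd (count_mem k w) = odd (count_mem k v).
Proof.
move=> /(congr1 (fun x : Z2infty => x k)); rewrite /word_vec.
rewrite (natr_F2 (count_mem k w)) (natr_F2 (count_mem k v)).
by case: (odd _); case: (odd _).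
Qed.

Section Classification.
Context {R : realType}.
Local Notation C := R[i].
Variable c : nat -> nat -> 'F_2.
Hypothesis c_sym : forall i j, c i j = c j i.
Hypothesis c_diag : forall i, c i i = 0.
Hypothesis c_rank : infinite_rank c.

(** On a radical word the scalars of [U] and [V] have equal squares, so their ratio is [sign2 e] for
    some [e]. This exponent is additive in the word and depends on its vector only; its extension
    from the radical is [gamma]. *)
Lemma twist_representative (H K : hilbertType R) (U : nat -> H -> H)
    (V : nat -> K -> K) :
  irreducible_spin_system c U -> irreducible_spin_system c V ->
  exists2 gamma : Z2infty,
    (forall j, ~ pivot (ker_omega c) j -> gamma j = 0) &
    spin_equiv V (twist gamma U).
Proof.
move=> iU iV; have [sU sV] := (iU.1, iV.1).
have [[u u0] _ _ _] := sU; have [[v v0] _ _ _] := sV.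
pose rho w (e : 'F_2) := forall a : C, (forall x, wordop U w x = a *: x) ->
  forall y, wordop V w y = (sign2 e * a) *: y.
have scal_inj (L : hilbertType R) (l : L) (a b : C) :
    l != 0 -> a *: l = b *: l -> a = b.
  move=> l0 /eqP; rewrite -subr_eq0 -scalerBl scaler_eq0 (negPf l0) orbF.
  by rewrite subr_eq0 => /eqP.
have scal (L : hilbertType R) (S : nat -> L -> L) (l : L) w (a : C) :
    spin_system c S -> l != 0 -> (forall x, wordop S w x = a *: x) ->
    a * a = sign2 (word_quad c w).
  move=> sS l0 aP; apply: (scal_inj _ _ _ _ l0); rewrite -scalerA -!aP.
  rewrite -[in RHS](wordopK_rev sS w l) (wordop_rev c_sym sS) (wordopZ sS).
  by rewrite scalerA sign2K scale1r.
have rho_ex w : word_ker c w -> exists e, rho w e.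
  move=> kw; have [a aP] := irreducible_ker c_sym iU kw.
  have [b bP] := irreducible_ker c_sym iV kw.
  have : b ^+ 2 == a ^+ 2.
    by rewrite !expr2 (scal _ _ _ _ _ sU u0 aP) (scal _ _ _ _ _ sV v0 bP).
  rewrite eqf_sqr => /orP[] /eqP ba; [exists 0|exists 1] => a' a'P y;
    have -> : a' = a by [apply: (scal_inj _ _ _ _ u0); rewrite -aP -a'P].
    by rewrite bP ba sign2_0 mul1r.
  by rewrite bP ba sign2_1 mulN1r.
have rho_cat w w' e e' : word_ker c w -> word_ker c w' ->
    rho w e -> rho w' e' -> rho (w ++ w') (e + e').
  move=> kw kw' we we' a aP y.
  have [b bP] := irreducible_ker c_sym iU kw.
  have [b' b'P] := irreducible_ker c_sym iU kw'.
  have -> : a = b * b'.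
    apply: (scal_inj _ _ _ _ u0).
    by rewrite -aP wordop_cat b'P (wordopZ sU) bP scalerA mulrC.
  rewrite wordop_cat (we' _ b'P) (wordopZ sV) (we _ bP) scalerA sign2D.
  by congr (_ *: _); ring.
(* Words with the same vector differ by a sign common to [U] and [V], which drops out of the
   ratio. *)
have rho_inj w w' e e' : word_ker c w -> word_vec w = word_vec w' ->
    rho w e -> rho w' e' -> e = e'.
  move=> kw ww' we we'.
  have [d dP] := wordop_parity c_sym R (fun k => word_vec_odd k ww').
  have [a aP] := irreducible_ker c_sym iU kw.
  have a'P x : wordop U w' x = (sign2 d * a) *: x.
    by rewrite -scalerA -aP dP // scalerA sign2K scale1r.
  have a0 : a != 0.
    apply: contraNneq u0 => a0; rewrite -(wordop_revK sU w u) aP a0 scale0r.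
    by rewrite (linmap0 (wordop_linear sU _)).
  have : (sign2 e * a) *: v = (sign2 e' * a) *: v.
    by rewrite -(we _ aP) dP // (we' _ a'P) scalerA mulrCA [sign2 d * (_ * _)]mulrA sign2K mul1r.
  by move=> /(scal_inj _ _ _ _ v0)/(mulIf a0)/sign2_inj.
pose F x e := ker_omega c x -> exists w, [/\ x = word_vec w, word_ker c w & rho w e].
have [f fP] : {f & forall x, F x (f x)}.
  apply: (@choice _ _ F) => x.
  have [kx|nk] := pselect (ker_omega c x); last by exists 0.
  have [w xw] := GammaP kx.1.
  have kw : word_ker c w by apply/(ker_omega_word_vec _ c_sym); rewrite -xw.
  by have [e we] := rho_ex w kw; exists e => _; exists w.
have [||gamma g0 gP] := @pivot_extension (ker_omega c) _ (ker_omegaD c_sym) f.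
- by move=> x [].
- move=> x y kx ky; have [w [xw kw we]] := fP x kx.
  have [w' [yw' kw' we']] := fP y ky.
  have [w2 [xyw2 kw2 we2]] := fP _ (ker_omegaD c_sym kx ky).
  apply: (rho_inj w2 (w ++ w')) => //; last exact: rho_cat.
  by rewrite word_vec_cat -xw -yw' -xyw2.
exists gamma => //.
apply: (same_scalars_equiv c_sym c_diag c_rank iV (twist_irreducible gamma iU)).
move=> w kw b bP x.
have kx : ker_omega c (word_vec w) by apply/(ker_omega_word_vec _ c_sym).
have [w' [ww' kw' we']] := fP _ kx; have [e we] := rho_ex w kw.
have [a aP] := irreducible_ker c_sym iU kw.
rewrite (wordop_twist _ _ _ sU) -pairing_word_vec gP // aP scalerA.
rewrite -(rho_inj _ _ _ _ kw ww' we we'); congr (_ *: _).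
by apply: (scal_inj _ _ _ _ v0); rewrite -bP (we _ aP).
Qed.

End Classification.

(** * The Hilbert space of square-summable sequences *)

Section ComplexSeries.
Context {R : realType}.
Local Notation C := R[i].
Implicit Types (u v : nat -> C) (a : C).

Definition sqmod a : R := complex.Re a ^+ 2 + complex.Im a ^+ 2.

Lemma sqmodE a : (sqmod a)%:C%C = a * a^*.
Proof. by rewrite /sqmod add_Re2_Im2 normCK. Qed.

Lemma sqmod_ge0 a : 0 <= sqmod a.
Proof. by rewrite addr_ge0 ?sqr_ge0. Qed.

Lemma sqmod_eq0 a : sqmod a = 0 -> a = 0.
Proof.
move=> a0; have /eqP : a * a^* = 0 by rewrite -sqmodE a0.
by rewrite mul_conjC_eq0 => /eqP.
Qed.

Lemma sqmodM a b : sqmod (a * b) = sqmod a * sqmod b.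
Proof. by case: a => a1 a2; case: b => b1 b2; rewrite /sqmod /=; ring. Qed.

(** The parallelogram identity, with [sqmod (a - b)] dropped. *)
Lemma sqmodD a b : sqmod (a + b) <= 2 * (sqmod a + sqmod b).
Proof.
rewrite -subr_ge0.
suff -> : 2 * (sqmod a + sqmod b) - sqmod (a + b) = sqmod (a - b).
  exact: sqmod_ge0.
by case: a => a1 a2; case: b => b1 b2; rewrite /sqmod /=; ring.
Qed.

Lemma dominated_series_cvg (u v : nat -> R) (B : R) :
  (forall k, `|u k| <= v k) -> (forall n, \sum_(0 <= k < n) v k <= B) ->
  cvgn (series u).
Proof.
move=> uv vB; apply: normed_cvg.
have v0 k : 0 <= v k by apply: le_trans (uv k).
apply: (@series_le_cvg _ (fun k => `|u k|) v) => //.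
apply: nondecreasing_is_cvgn; first by apply: nondecreasing_series => n _ _.
by exists B => _ [n _ <-]; exact: vB.
Qed.

Definition summable u : Prop :=
  cvgn (series (fun k => complex.Re (u k))) /\
  cvgn (series (fun k => complex.Im (u k))).

(** Real and imaginary parts are summed separately, so that the tests for real series apply. *)
Definition csum u : C :=
  (limn (series (fun k => complex.Re (u k)))
    +i* limn (series (fun k => complex.Im (u k))))%C.

Lemma csumD u v : summable u -> summable v ->
  csum (fun k => u k + v k) = csum u + csum v.
Proof.
move=> [ru iu] [rv iv]; rewrite /csum.
have -> : series (fun k => complex.Re (u k + v k)) =
    series (fun k => complex.Re (u k)) + series (fun k => complex.Re (v k)).
  apply/funext => n; rewrite -[RHS]/(series _ n + series _ n) /series /= -big_split.
  by apply: eq_bigr => k _; case: (u k); case: (v k).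
have -> : series (fun k => complex.Im (u k + v k)) =
    series (fun k => complex.Im (u k)) + series (fun k => complex.Im (v k)).
  apply/funext => n; rewrite -[RHS]/(series _ n + series _ n) /series /= -big_split.
  by apply: eq_bigr => k _; case: (u k); case: (v k).
by rewrite !limD.
Qed.

Lemma limn_lin2 (s t : nat -> R) (a b : R) : cvgn s -> cvgn t ->
  limn (fun n => a * s n + b * t n) = a * limn s + b * limn t.
Proof.
move=> cs ct; apply: cvg_lim => //.
by apply: cvgD; apply: cvgM => //; apply: cvg_cst.
Qed.

Lemma csumZ a u : summable u -> csum (fun k => a * u k) = a * csum u.
Proof.
case: a => a1 a2 [ru iu]; rewrite /csum.
have -> : series (fun k => complex.Re ((a1 +i* a2)%C * u k)) =
    (fun n => a1 * series (fun k => complex.Re (u k)) n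
            + (- a2) * series (fun k => complex.Im (u k)) n).
  apply/funext => n; rewrite /series /= !mulr_sumr -big_split; apply: eq_bigr => k _.
  by case: (u k) => x y /=; rewrite mulNr.
have -> : series (fun k => complex.Im ((a1 +i* a2)%C * u k)) =
    (fun n => a1 * series (fun k => complex.Im (u k)) n
            + a2 * series (fun k => complex.Re (u k)) n).
  apply/funext => n; rewrite /series /= !mulr_sumr -big_split; apply: eq_bigr => k _.
  by case: (u k).
by rewrite !limn_lin2 // mulNr.
Qed.

Lemma csum_conj u : summable u -> csum (fun k => (u k)^*) = (csum u)^*.
Proof.
move=> [ru iu]; rewrite /csum.
have -> : (fun k => complex.Re ((u k)^*)) = (fun k => complex.Re (u k)).
  by apply/funext => k; case: (u k).
have -> : series (fun k => complex.Im ((u k)^*)) =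
    - series (fun k => complex.Im (u k)).
  apply/funext => n; rewrite -[RHS]/(- series _ n) /series /= -sumrN.
  apply: eq_bigr => k _.
  by case: (u k).
by rewrite limN.
Qed.

End ComplexSeries.

Section SquareSummable.
Variable R : realType.
Local Notation C := R[i].

Definition sqsum (f : nat -> C) (n : nat) : R := \sum_(0 <= k < n) sqmod (f k).

Definition square_summable : {pred (nat -> C)} :=
  [pred f | `[< exists B, forall n, sqsum f n <= B >]].

Lemma square_summable_submod : submod_closed square_summable.
Proof.
split=> [|a f g /asboolP[A fA] /asboolP[B gB]].
  apply/asboolP; exists 0 => n; rewrite /sqsum big1 // => k _.
  by rewrite /sqmod /= expr0n addr0.
apply/asboolP; exists (2 * (sqmod a * A + B)) => n.
apply: (@le_trans _ _ (2 * (sqmod a * sqsum f n + sqsum g n))).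
  rewrite /sqsum !mulr_sumr -big_split mulr_sumr; apply: ler_sum => k _.
  by rewrite -sqmodM; exact: sqmodD.
by rewrite ler_pM2l // lerD // ler_wpM2l // sqmod_ge0.
Qed.

HB.instance Definition _ := GRing.isSubmodClosed.Build _ _ square_summable
  square_summable_submod.

Record l2 := L2 { l2_val :> nat -> C; _ : l2_val \in square_summable }.

HB.instance Definition _ := [isSub for l2_val].
HB.instance Definition _ := [Choice of l2 by <:].
HB.instance Definition _ := [SubChoice_isSubLmodule of l2 by <:].

Lemma l2_bound (f : l2) : exists B, forall n, sqsum f n <= B.
Proof. by have /asboolP := valP f. Qed.

Lemma l2_summable (f g : l2) : summable (fun k => f k * (g k)^*).
Proof.
have [A fA] := l2_bound f; have [B gB] := l2_bound g.
have AB n : \sum_(0 <= k < n) (sqmod (f k) + sqmod (g k)) <= A + B.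
  by rewrite big_split; apply: lerD; [exact: fA|exact: gB].
(* Each of the four bounds amounts to the nonnegativity of half a sum of squares. *)
split; apply: (dominated_series_cvg _ AB) => k; case: (f k) (g k) => a b [u v];
  rewrite /sqmod /= ler_norml; apply/andP; split; rewrite -subr_ge0.
- rewrite (_ : _ - _ = ((a + u) ^+ 2 + (a ^+ 2 + u ^+ 2)
      + (b + v) ^+ 2 + (b ^+ 2 + v ^+ 2)) / 2);
    last by field.
  by rewrite divr_ge0 // !addr_ge0 ?sqr_ge0.
- rewrite (_ : _ - _ = ((a - u) ^+ 2 + (a ^+ 2 + u ^+ 2)
      + (b - v) ^+ 2 + (b ^+ 2 + v ^+ 2)) / 2);
    last by field.
  by rewrite divr_ge0 // !addr_ge0 ?sqr_ge0.
- rewrite (_ : _ - _ = ((a - v) ^+ 2 + (a ^+ 2 + v ^+ 2)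
      + (b + u) ^+ 2 + (b ^+ 2 + u ^+ 2)) / 2);
    last by field.
  by rewrite divr_ge0 // !addr_ge0 ?sqr_ge0.
- rewrite (_ : _ - _ = ((a + v) ^+ 2 + (a ^+ 2 + v ^+ 2)
      + (b - u) ^+ 2 + (b ^+ 2 + u ^+ 2)) / 2);
    last by field.
  by rewrite divr_ge0 // !addr_ge0 ?sqr_ge0.
Qed.

Definition l2_inner (f g : l2) : C := csum (fun k => f k * (g k)^*).

Lemma l2_innerC (f g : l2) : l2_inner f g = (-1) ^+ false * (l2_inner g f)^*.
Proof.
rewrite mul1r /l2_inner -csum_conj; last exact: l2_summable.
by congr csum; apply/funext => k; rewrite rmorphM /= conjCK mulrC.
Qed.

Lemma l2_inner_linear (a : C) (f g h : l2) :
  l2_inner (a *: f + g) h = a * l2_inner f h + l2_inner g h.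
Proof.
rewrite /l2_inner -csumZ; last exact: l2_summable.
rewrite -csumD; last exact: l2_summable; first last.
  by have := l2_summable (a *: f) h; under eq_fun => k do rewrite -[_ k]/(a * f k) -mulrA.
congr csum; apply/funext => k.
by rewrite -[(_ + _ : l2) k]/(a * f k + g k) mulrDl mulrA.
Qed.

Lemma l2_inner_bilinear : bilinear_for *%R (Num.conj \; *%R) l2_inner.
Proof.
split=> [h a f g|h a f g]; first exact: l2_inner_linear.
have C0 x y : l2_inner x y = (l2_inner y x)^* by rewrite l2_innerC mul1r.
by rewrite C0 l2_inner_linear rmorphD rmorphM /= -!C0.
Qed.

HB.instance Definition _ := bilinear_isBilinear.Build C l2 l2 C
  *%R (Num.conj \; *%R) l2_inner l2_inner_bilinear.
HB.instance Definition _ := isHermitianSesquilinear.Build C l2 false Num.conj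
  l2_inner l2_innerC.

Definition l2_sqnorm (f : l2) : R := limn (sqsum f).

Lemma sqsum_nd (f : nat -> C) : nondecreasing_seq (sqsum f).
Proof. by apply: nondecreasing_series => n _ _; exact: sqmod_ge0. Qed.

Lemma sqsum_cvg (f : l2) : cvgn (sqsum f).
Proof.
apply: nondecreasing_is_cvgn; first exact: sqsum_nd.
by have [B fB] := l2_bound f; exists B => _ [n _ <-].
Qed.

Lemma l2_sqnorm_ge (f : l2) n : sqsum f n <= l2_sqnorm f.
Proof. by apply: nondecreasing_cvgn_le; [exact: sqsum_nd|exact: sqsum_cvg]. Qed.

Lemma l2_sqnorm_le (f : l2) B : (forall n, sqsum f n <= B) -> l2_sqnorm f <= B.
Proof.
move=> fB; apply: limr_le; first exact: sqsum_cvg.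
by near=> n; exact: fB.
Unshelve. all: by end_near. Qed.

Lemma sqmod_le_l2 (f : l2) k : sqmod (f k) <= l2_sqnorm f.
Proof.
apply: le_trans (l2_sqnorm_ge f k.+1).
rewrite /sqsum big_nat_recr //= lerDr sumr_ge0 // => j _; exact: sqmod_ge0.
Qed.

Lemma l2_inner_self (f : l2) : l2_inner f f = (l2_sqnorm f)%:C%C.
Proof.
have ReE k : complex.Re (f k * (f k)^*) = sqmod (f k) by rewrite -sqmodE.
have ImE k : complex.Im (f k * (f k)^*) = 0 by rewrite -sqmodE.
rewrite /l2_inner /csum (funext ReE) (funext ImE).
rewrite (_ : series (fun=> 0) = fun=> 0) ?lim_cst //.
by apply/funext => n; rewrite /series /= big1.
Qed.

Lemma l2_inner_gt0 (f : l2) : f != 0 -> 0 < l2_inner f f.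
Proof.
move=> f0; have f_ge0 : 0 <= l2_sqnorm f.
  by apply: le_trans (l2_sqnorm_ge f 0); rewrite /sqsum big_geq.
rewrite l2_inner_self (ltcR 0) lt_def f_ge0 andbT.
apply: contraNneq f0 => fn0; apply/eqP/val_inj/funext => k /=.
apply: sqmod_eq0; apply/eqP; rewrite eq_le sqmod_ge0 andbT -fn0.
exact: sqmod_le_l2.
Qed.

HB.instance Definition _ := isDotProduct.Build C l2 l2_inner l2_inner_gt0.

Definition l2_norm (f : l2) : C := sqrtC (l2_inner f f).

Lemma l2_normD (f g : l2) : l2_norm (f + g) <= l2_norm f + l2_norm g.
Proof. exact: dot_triangle. Qed.

Lemma l2_normZ (a : C) (f : l2) : l2_norm (a *: f) = `|a| * l2_norm f.
Proof.
rewrite /l2_norm dnormZ sqrtCM ?nnegrE ?exprn_ge0 // sqrCK //.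
Qed.

Lemma l2_norm_eq0 (f : l2) : l2_norm f = 0 -> f = 0.
Proof. by move=> /eqP; rewrite sqrtC_eq0 dnorm_eq0 => /eqP. Qed.

HB.instance Definition _ := Lmodule_isNormed.Build C l2
  l2_normD l2_normZ l2_norm_eq0.

Lemma l2_normE (f : l2) : l2_inner f f = `|f| ^+ 2.
Proof. by rewrite sqrtCK. Qed.

End SquareSummable.

Section Completeness.
Variable R : realType.
Local Notation C := R[i].

Lemma harmonic_lt (r : R) : 0 < r -> exists N, forall n, (N <= n)%N -> n.+1%:R^-1 < r.
Proof.
move=> r0; have [N _ NP] := (@cvgr_lt _ _ _ _ _ _ (@cvg_harmonic R)) r r0.
by exists N => n Nn; exact: NP.
Qed.

Lemma harmonic_cauchy (u : nat -> R) :
  (forall n m, `|u n - u m| <= n.+1%:R^-1 + m.+1%:R^-1) -> cvgn u.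
Proof.
move=> uc; apply/cauchy_cvgP/cauchy_exP => r r0.
have [N NP] := harmonic_lt (divr_gt0 r0 (ltr0Sn R 1)).
exists (u N); exists N => // n /= Nn; rewrite /ball /=.
apply: (le_lt_trans (uc _ _)); rewrite [ltRHS]splitr.
by apply: ltrD; apply: NP.
Qed.

Lemma l2_norm_le (f : l2 R) (r : R) : 0 <= r ->
  (`|f| <= r%:C%C) = (l2_sqnorm f <= r ^+ 2).
Proof.
move=> r0; rewrite -(@ler_pXn2r _ 2) ?nnegrE ?ler0c // -l2_normE l2_inner_self.
by rewrite -rmorphXn lecR.
Qed.

Lemma real_complex_invn n : (n.+1%:R^-1 : R)%:C%C = n.+1%:R^-1 :> C.
Proof. by rewrite fmorphV /= rmorph_nat. Qed.

(** The limit is taken coordinate by coordinate; for fixed [n] the bound on a partial sum of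
    [X n - X m] survives as [m] grows, uniformly in the number of terms. *)
Lemma l2_seq_complete (X : nat -> l2 R) :
  (forall n m, `|X n - X m| <= n.+1%:R^-1 + m.+1%:R^-1) ->
  exists l, forall n, `|X n - l| <= 2 * n.+1%:R^-1.
Proof.
move=> Xc.
have inv0 n : 0 <= n.+1%:R^-1 :> R by rewrite invr_ge0.
have d n m : l2_sqnorm (X n - X m) <= (n.+1%:R^-1 + m.+1%:R^-1) ^+ 2.
  by rewrite -l2_norm_le ?addr_ge0 // rmorphD /= !real_complex_invn.
have dk n m k : sqmod (X n k - X m k) <= (n.+1%:R^-1 + m.+1%:R^-1) ^+ 2.
  by apply: le_trans (d n m); exact: (sqmod_le_l2 (X n - X m) k).
have nm0 n m : 0 <= n.+1%:R^-1 + m.+1%:R^-1 :> R by rewrite addr_ge0.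
have cRe k : cvgn (fun n => complex.Re (X n k)).
  apply: harmonic_cauchy => n m.
  rewrite -(@ler_pXn2r _ 2) ?nnegrE // real_normK ?num_real //.
  apply: le_trans (dk n m k); rewrite /sqmod.
  by case: (X n k) (X m k) => a b [a' b'] /=; rewrite lerDl sqr_ge0.
have cIm k : cvgn (fun n => complex.Im (X n k)).
  apply: harmonic_cauchy => n m.
  rewrite -(@ler_pXn2r _ 2) ?nnegrE // real_normK ?num_real //.
  apply: le_trans (dk n m k); rewrite /sqmod.
  by case: (X n k) (X m k) => a b [a' b'] /=; rewrite lerDr sqr_ge0.
pose L (k : nat) : C := (limn (fun n => complex.Re (X n k))
   +i* limn (fun n => complex.Im (X n k)))%C.
have sL n K : sqsum (fun k => X n k - L k) K <= (2 * n.+1%:R^-1) ^+ 2.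
  have ck k : (fun m => sqmod (X n k - X m k)) @ \oo --> sqmod (X n k - L k).
    rewrite /sqmod.
    have -> : (fun m => complex.Re (X n k - X m k) ^+ 2
                      + complex.Im (X n k - X m k) ^+ 2) =
      (fun m => (complex.Re (X n k) - complex.Re (X m k))
              * (complex.Re (X n k) - complex.Re (X m k))
              + (complex.Im (X n k) - complex.Im (X m k))
              * (complex.Im (X n k) - complex.Im (X m k))).
      apply/funext => m.
      by case: (X n k) (X m k) => a b [a' b'] /=; rewrite !expr2.
    have -> : complex.Re (X n k - L k) ^+ 2 + complex.Im (X n k - L k) ^+ 2 =
       (complex.Re (X n k) - complex.Re (L k)) * (complex.Re (X n k) - complex.Re (L k))
     + (complex.Im (X n k) - complex.Im (L k)) * (complex.Im (X n k) - complex.Im (L k)).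
      by rewrite /L; case: (X n k) => a b /=; rewrite !expr2.
    have cR : (fun m => complex.Re (X n k) - complex.Re (X m k)) @ \oo
        --> complex.Re (X n k) - complex.Re (L k).
      by apply: cvgB; [exact: cvg_cst|exact: cRe].
    have cI : (fun m => complex.Im (X n k) - complex.Im (X m k)) @ \oo
        --> complex.Im (X n k) - complex.Im (L k).
      by apply: cvgB; [exact: cvg_cst|exact: cIm].
    exact: cvgD (cvgM cR cR) (cvgM cI cI).
  have cs : (fun m => sqsum (fun k => X n k - X m k) K) @ \oo
      --> sqsum (fun k => X n k - L k) K.
    elim: (K) => [|J IHJ].
      rewrite /sqsum big_geq //; apply: cvg_near_cst.
      by apply: nearW => m; rewrite big_geq.
    rewrite /sqsum big_nat_recr //=; under eq_fun => m do rewrite big_nat_recr //=.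
    by apply: cvgD; [exact: IHJ|exact: ck].
  have <- := cvg_lim (@Rhausdorff R) cs.
  apply: limr_le; first by apply/cvg_ex; eexists; exact: cs.
  (* For [m >= n], the bound [1/(n+1) + 1/(m+1)] is at most [2/(n+1)]. *)
  exists n => // m /= nm; apply: (@le_trans _ _ (l2_sqnorm (X n - X m))).
    exact: (l2_sqnorm_ge (X n - X m) K).
  apply: (le_trans (d n m)); rewrite ler_pXn2r ?nnegrE ?mulr_ge0 //.
  by rewrite mulr_natl mulr2n lerD2l lef_pV2 ?posrE // ler_nat.
have Dn n : (fun k => X n k - L k) \in @square_summable R.
  by apply/asboolP; exists ((2 * n.+1%:R^-1) ^+ 2) => K; exact: sL.
have Ls : L \in @square_summable R.
  have -> : L = (X 0%N : nat -> C) - (fun k => X 0%N k - L k).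
    by apply/funext => k; rewrite -[RHS]/(X 0%N k - (X 0%N k - L k)) subKr.
  by rewrite rpredB //; exact: (valP (X 0%N)).
exists (L2 Ls) => n.
have -> : 2 * n.+1%:R^-1 = (2 * n.+1%:R^-1 : R)%:C%C.
  by rewrite rmorphM /= real_complex_invn rmorph_nat.
by rewrite l2_norm_le ?mulr_ge0 //; apply: l2_sqnorm_le => K; exact: sL.
Qed.

Lemma l2_complete (F : set_system (l2 R)) : ProperFilter F -> cauchy F -> cvg F.
Proof.
move=> FF /cauchyP Fc.
have [X XP] : {X & forall n, F (ball (X n) (n.+1%:R^-1 : C))}.
  apply: (@choice _ _ (fun n x => F (ball x (n.+1%:R^-1 : C)))) => n.
  by apply: Fc; rewrite invr_gt0 ltr0n.
have [n m|l lP] := @l2_seq_complete X.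
  have [y [yn ym]] := filter_ex (filterI (XP n) (XP m)).
  rewrite -(subrK y (X n)) -addrA; apply: (le_trans (ler_normD _ _)).
  move: yn ym; rewrite -ball_normE /= => /ltW yn /ltW ym.
  by rewrite lerD // distrC.
apply/cvg_ex; exists l; apply/cvg_ballP => e e0.
have e0' : 0 < complex.Re e by rewrite -ltcR RRe_real // gtr0_real.
(* A third of [e] is needed: [l] is within [2/(N+1)] of [X N], and the ball around [X N] has radius
   [1/(N+1)]. *)
have [N NP] := harmonic_lt (divr_gt0 e0' (ltr0Sn R 2)).
have {NP} := NP N (leqnn N); rewrite ltr_pdivlMr // -ltcR rmorphM /= real_complex_invn.
rewrite RRe_real ?gtr0_real // rmorph_nat => Ne.
apply: filterS (XP N) => y; rewrite -ball_normE /= => yN.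
apply: le_lt_trans Ne; rewrite -(subrK (X N) l) -addrA.
apply: (le_trans (ler_normD _ _)); rewrite distrC.
rewrite mulrC (_ : 3%:R = 2 + 1 :> C) ?mulrDl ?mul1r; last by rewrite -natr1.
have h := lP N; rewrite mulrDl mul1r in h; exact: lerD h (ltW yN).
Qed.

HB.instance Definition _ := Uniform_isComplete.Build (l2 R) l2_complete.

HB.instance Definition _ := CompleteNormedModule_isHilbert.Build R (l2 R)
  (@l2_normE R).

End Completeness.

(** * Existence of an irreducible spin system *)

(** The digit [i] has weight [2 ^ i], whatever the number of pairs; [pauli_sign] counts from the
    other end. *)
Fixpoint nbit (i m : nat) : bool := if i is j.+1 then nbit j m./2 else odd m.

Fixpoint nflip (i m : nat) : nat :=
  if i is j.+1 then odd m + (nflip j m./2).*2 else ~~ odd m + m./2.*2.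

Lemma odd_bit_double (b : bool) m : odd (b + m.*2) = b.
Proof. by rewrite oddD odd_double addbF; case: b. Qed.

Lemma nflipK i : involutive (nflip i).
Proof.
elim: i => [|i IHi] m /=; rewrite odd_bit_double half_bit_double ?negbK ?IHi;
  exact: odd_double_half.
Qed.

Lemma nflipC i j m : nflip i (nflip j m) = nflip j (nflip i m).
Proof.
elim: i j m => [|i IHi] [|j] m //=; rewrite !odd_bit_double !half_bit_double //.
by rewrite IHi.
Qed.

Lemma nbit_nflip i j m : nbit i (nflip j m) = (i == j) (+) nbit i m.
Proof.
elim: i j m => [|i IHi] [|j] m //=; rewrite ?odd_bit_double ?half_bit_double //.
Qed.

Lemma nbit_inj m n : (forall i, nbit i m = nbit i n) -> m = n.
Proof.
have [k] := ubnP (m + n); elim: k m n => // k IHk m n mnk h.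
have [/eqP|mn0] := eqVneq (m + n)%N 0%N.
  by rewrite addn_eq0 => /andP[/eqP-> /eqP->].
rewrite -(odd_double_half m) -(odd_double_half n) (h 0%N : odd m = odd n).
congr (_ + _.*2)%N; apply: IHk => [|i]; last exact: (h i.+1).
apply: (@leq_ltn_trans (m + n)./2).
  by rewrite halfD leq_addl.
apply: leq_trans (_ : (m + n <= k)%N); last by rewrite -ltnS.
by rewrite ltn_half_double -addnn -[ltnLHS]addn0 ltn_add2l lt0n.
Qed.

(** Clear the lowest digit equal to 1. Iterated, this links every label to [0] by flips. *)
Lemma nflip_lt m : (0 < m)%N -> exists i, (nflip i m < m)%N.
Proof.
elim/ltn_ind: m => m IHm m0; have [om|em] := boolP (odd m).
  by exists 0%N; rewrite /= om add0n -{2}(odd_double_half m) om.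
have m2 : (0 < m./2)%N.
  by rewrite half_gt0; case: (m) em m0 => [|[]].
have [|i hi] := IHm m./2 _ m2.
  by rewrite ltn_half_double -addnn -{1}[m]addn0 ltn_add2l.
exists i.+1; rewrite /= (negbTE em) add0n.
rewrite -{2}(odd_double_half m) (negbTE em) add0n ltn_double //.
Qed.

Section Monomial.
Context {R : realType} {H : hilbertType R}.
Local Notation C := R[i].
Variable e : nat -> H.
Hypothesis be : orthobasis e.
Hypothesis e0 : forall i, e i != 0.

Lemma basis_ext x y : (forall i, inner x (e i) = inner y (e i)) -> x = y.
Proof.
move=> xy; apply/eqP; rewrite -subr_eq0; apply/eqP/be.2 => i.
by rewrite innerBl xy subrr.
Qed.

Definition monomial (s : nat -> bool) (p : nat -> nat) : H -> H :=
  osum e (fun i => (-1) ^+ s i *: e (p i)).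

Section OneMonomial.
Variables (s : nat -> bool) (p : nat -> nat).
Hypothesis pK : involutive p.
Hypothesis sp : forall i, s (p i) = s i.

Lemma monomial_orthosys : orthosys (fun i => (-1 : C) ^+ s i *: e (p i)).
Proof.
have [[eo en] _] := be; split=> [i j ij|i].
  rewrite innerZl innerZr eo ?mulr0 //; apply: contraNneq ij.
  by move=> /(can_inj pK)->.
rewrite innerZl innerZr en e0 scaler_eq0 signr_eq0 (negPf (e0 _)).
by rewrite rmorph_sign mulr1 -expr2 sqrr_sign.
Qed.

Lemma monomial_linear : linear (monomial s p).
Proof. exact: osum_linear be.1 monomial_orthosys. Qed.

Lemma monomial_inner x i :
  inner (monomial s p x) (e i) = (-1) ^+ s i * inner x (e (p i)).
Proof.
have := osum_inner x (p i) be.1 monomial_orthosys.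
rewrite pK sp innerZr rmorph_sign scaler_eq0 signr_eq0 (negPf (e0 _)) mul1r => <-.
by rewrite mulrA -expr2 sqrr_sign mul1r.
Qed.

Lemma monomial_basis i : monomial s p (e i) = (-1) ^+ s i *: e (p i).
Proof. by rewrite /monomial osum_basis ?e0 ?scale1r //; exact: be.1. Qed.

Lemma monomial_sa : self_adjoint (monomial s p).
Proof.
move=> x y; rewrite /monomial osum_adjoint; [|exact: be.1|exact: monomial_orthosys].
congr (inner _ _); apply: basis_ext => i.
rewrite monomial_inner osum_inner; [|exact: monomial_orthosys|exact: be.1].
by rewrite e0 mul1r innerZr rmorph_sign.
Qed.

Lemma monomialK : involutive (monomial s p).
Proof.
move=> x; apply: basis_ext => i.
by rewrite !monomial_inner sp pK mulrA -expr2 sqrr_sign mul1r.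
Qed.

End OneMonomial.

Definition pauliZ (i : nat) : H -> H := monomial (nbit i) id.
Definition pauliX (i : nat) : H -> H := monomial (fun=> false) (nflip i).

Lemma pauliZ_inner i x m : inner (pauliZ i x) (e m) = (-1) ^+ nbit i m * inner x (e m).
Proof. exact: monomial_inner. Qed.

Lemma pauliX_inner i x m : inner (pauliX i x) (e m) = inner x (e (nflip i m)).
Proof. by rewrite monomial_inner ?mul1r //; exact: nflipK. Qed.

Definition pauli_gen (k : nat) : H -> H :=
  if odd k then pauliX k./2 else pauliZ k./2.

Definition pauli_comm (k l : nat) : 'F_2 :=
  ((k./2 == l./2) && (odd k != odd l))%:R.

Lemma pauli_gen_linear k : linear (pauli_gen k).
Proof.
by rewrite /pauli_gen; case: odd; apply: monomial_linear => //; exact: nflipK.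
Qed.

Lemma pauli_gen_sa k : self_adjoint (pauli_gen k).
Proof.
by rewrite /pauli_gen; case: odd; apply: monomial_sa => //; exact: nflipK.
Qed.

Lemma pauli_genK k : involutive (pauli_gen k).
Proof.
by rewrite /pauli_gen; case: odd; apply: monomialK => //; exact: nflipK.
Qed.

Lemma pauli_gen_spin : spin_system pauli_comm pauli_gen.
Proof.
split=> [|k|k|k l x]; first by exists (e 0%N).
- exact: pauli_gen_sa.
- apply: (@adjoint_unitary _ _ _ _ (pauli_gen k)); try exact: pauli_gen_linear.
  + exact: pauli_gen_sa.
  + exact: pauli_genK.
  + exact: pauli_genK.
rewrite /pauli_comm; case ok: (odd k); case ol: (odd l);
  rewrite /pauli_gen ok ol /= ?andbF ?andbT; apply: basis_ext => m;
  rewrite innerZl ?(pauliX_inner, pauliZ_inner) ?sign2_0 ?mul1r.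
- by rewrite nflipC.
- rewrite nbit_nflip eq_sym; case: eqP => _; rewrite ?sign2_0 ?sign2_1 ?mul1r //.
  by case: nbit; rewrite /= !expr1 !expr0 !mulN1r !mul1r ?opprK.
- rewrite nbit_nflip; case: eqP => _; rewrite ?sign2_0 ?sign2_1 ?mul1r //.
  by case: nbit; rewrite /= !expr1 !expr0 !mulN1r !mul1r ?opprK.
- by rewrite mulrCA.
Qed.

(** Commuting with [pauliZ] kills the off-diagonal entries of [T], as distinct labels differ in some
    digit; commuting with [pauliX] makes the diagonal constant, as flips link all labels. Continuity
    extends this from the basis. *)
Lemma pauli_gen_commutant (T : H -> H) :
  bounded_operator T -> (forall k x, T (pauli_gen k x) = pauli_gen k (T x)) ->
  exists a : C, forall x, T x = a *: x.
Proof.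
move=> [lT cT] comm; have [oe te] := be.
have ee i : inner (e i) (e i) = 1 by rewrite oe.2 e0.
have TZ i x : T (pauliZ i x) = pauliZ i (T x).
  by have := comm i.*2 x; rewrite /pauli_gen odd_double doubleK.
have TX i x : T (pauliX i x) = pauliX i (T x).
  by have := comm i.*2.+1 x; rewrite /pauli_gen /= odd_double /= uphalf_double.
pose t m := inner (T (e m)) (e m).
have tflip i m : t (nflip i m) = t m.
  rewrite /t -pauliX_inner -TX; congr (inner (T _) _).
  by rewrite /pauliX monomial_basis // ?scale1r ?nflipK // => j; exact: nflipK.
have t0 m : t m = t 0%N.
  elim/ltn_ind: m => -[//|m] IHm; have [i hi] := nflip_lt (ltn0Sn m).
  by rewrite -(tflip i) IHm.
have Te m : T (e m) = t 0%N *: e m.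
  apply: basis_ext => n; rewrite innerZl.
  have [<-|mn] := eqVneq m n; first by rewrite ee mulr1 -(t0 m).
  rewrite oe.1 // mulr0; have [i im] : exists i, nbit i m != nbit i n.
    apply: contrapT => nh; apply/negP: mn; rewrite negbK; apply/eqP/nbit_inj => i.
    by apply/eqP; apply: contrapT => /negP h; apply: nh; exists i.
  apply: opp_self_eq0.
  have h1 : inner (T (pauliZ i (e m))) (e n) = (-1) ^+ nbit i n * inner (T (e m)) (e n).
    by rewrite TZ pauliZ_inner.
  have h2 : inner (T (pauliZ i (e m))) (e n) = (-1) ^+ nbit i m * inner (T (e m)) (e n).
    by rewrite /pauliZ monomial_basis // (linmapZ lT) innerZl.
  move: h1; rewrite h2; case: (nbit i m) (nbit i n) im => -[] //= _.
    by rewrite expr1 expr0 mulN1r mul1r => /esym.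
  by rewrite expr1 expr0 mulN1r mul1r.
exists (t 0%N) => x.
have sx := osum_cvg (x := x) oe oe; rewrite osum_total // in sx.
have Ts : (T \o series (fun i => inner x (e i) *: e i)) @ \oo --> T x.
  by apply: continuous_cvg sx; exact: cT.
apply: (cvg_unique _ Ts); first exact: norm_hausdorff.
have -> : T \o series (fun i => inner x (e i) *: e i) =
    (fun n => t 0%N *: series (fun i => inner x (e i) *: e i) n).
  apply/funext => n; rewrite /series /= scaler_sumr.
  rewrite (big_morph T (linmapD lT) (linmap0 lT)); apply: eq_bigr => i _.
  by rewrite (linmapZ lT) Te !scalerA mulrC.
exact: cvgZl_tmp.
Qed.

End Monomial.

Section Existence.
Context {R : realType}.
Local Notation C := R[i].
Variable c : nat -> nat -> 'F_2.
Hypothesis c_sym : forall i j, c i j = c j i.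
Hypothesis c_diag : forall i, c i i = 0.
Hypothesis c_rank : infinite_rank c.

Lemma pauli_comm_sym k l : pauli_comm k l = pauli_comm l k.
Proof. by rewrite /pauli_comm [k./2 == _]eq_sym [odd k == _]eq_sym. Qed.

Let p0 (i : nat) : seq nat := [:: i.*2].
Let q0 (i : nat) : seq nat := [:: i.*2.+1].

Lemma pauli_comm_hyperbolic n : hyperbolic pauli_comm p0 q0 n.
Proof.
move=> i j _ _; rewrite !word_form1 /pauli_comm /= !odd_double /= !andbF.
by rewrite !uphalf_double !doubleK andbT.
Qed.

Lemma word_comb_vec_even f g n j :
  word_vec (word_comb p0 q0 f g n) j.*2 = if (j < n)%N then f j else 0.
Proof.
elim: n => //= n IHn; rewrite !word_vec_cat !word_vec_scale.
rewrite -[LHS]/(f n * word_vec (p0 n) j.*2 + (g n * word_vec (q0 n) j.*2 +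
   word_vec (word_comb p0 q0 f g n) j.*2)) IHn /word_vec /= !addn0.
have -> : (n.*2.+1 == j.*2) = false.
  by apply/eqP => /(congr1 odd); rewrite /= !odd_double.
rewrite mulr0 add0r (inj_eq double_inj) ltnS.
by case: (ltngtP j n) => [_|_|->]; rewrite ?mulr0 ?mulr1 ?add0r ?addr0.
Qed.

Lemma word_comb_vec_odd f g n j :
  word_vec (word_comb p0 q0 f g n) j.*2.+1 = if (j < n)%N then g j else 0.
Proof.
elim: n => //= n IHn; rewrite !word_vec_cat !word_vec_scale.
rewrite -[LHS]/(f n * word_vec (p0 n) j.*2.+1 + (g n * word_vec (q0 n) j.*2.+1 +
   word_vec (word_comb p0 q0 f g n) j.*2.+1)) IHn /word_vec /= !addn0.
have -> : (n.*2 == j.*2.+1) = false.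
  by apply/eqP => /(congr1 odd); rewrite /= !odd_double.
rewrite mulr0 add0r eqSS (inj_eq double_inj) ltnS.
by case: (ltngtP j n) => [_|_|->]; rewrite ?mulr0 ?mulr1 ?add0r ?addr0.
Qed.

(** Generator [k] becomes the word [w k] of model pairs with its symplectic coordinates; the form is
    preserved because [k] differs from the combination of its own pairs by a radical word.
    Substituted into [p j] and [q j], these words act as model generators up to sign, so
    irreducibility is inherited from the model. *)
Lemma irreducible_of_basis (H : hilbertType R) (e : nat -> H) :
  orthobasis e -> (forall i, e i != 0) ->
  exists U : nat -> H -> H, irreducible_spin_system c U.
Proof.
move=> be e0; pose S := pauli_gen e.
have sS : spin_system pauli_comm S := pauli_gen_spin be e0.
have [p [q [hpq redk]]] := symplectic_sequence c_sym c_diag c_rank.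
have /choice[n nP] : forall k, exists n, word_ker c (word_red c p q n [:: k]).
  by move=> k; have [n nP] := redk k; exists n; exact: nP.
have h i j := hpq (maxn i j).+1 i j (leq_maxl i j) (leq_maxr i j).
have h0 i j := @pauli_comm_hyperbolic (maxn i j).+1 i j
  (leq_maxl i j) (leq_maxr i j).
pose f k i := word_form c [:: k] (q i); pose g k i := word_form c [:: k] (p i).
have form_n k v : word_form c [:: k] v = word_form c (word_comb p q (f k) (g k) (n k)) v.
  have := word_kerP c_sym v (nP k); rewrite word_form_catl.
  by move/eqP; rewrite addr_eq0 F2_oppr => /eqP.
(* Coordinates vanish from [n k] on, so truncation there leaves [w k] with the right pairings at
   every index. *)
have fn k i : (n k <= i)%N -> f k i = 0.
  move=> ki; rewrite /f form_n word_comb_form big1 // => j _.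
  have lt_ji : (j < i)%N := leq_trans (ltn_ord j) ki.
  have [_ -> ->] := h j i; by rewrite ltn_eqF // !mulr0 addr0.
have gn k i : (n k <= i)%N -> g k i = 0.
  move=> ki; rewrite /g form_n word_comb_form big1 // => j _.
  have lt_ji : (j < i)%N := leq_trans (ltn_ord j) ki.
  have [-> _ _] := h j i; have [_ _] := h i j.
  by rewrite (word_formC c_sym) => ->; rewrite gtn_eqF // !mulr0 addr0.
pose w k := word_comb p0 q0 (f k) (g k) (n k).
have wp k i : word_form pauli_comm (w k) (p0 i) = g k i.
  have [ki|ik] := leqP (n k) i; last first.
    by rewrite (word_comb_p pauli_comm_sym _ _ (@pauli_comm_hyperbolic _) ik).
  rewrite gn // word_comb_form big1 // => j _.
  have lt_ji : (j < i)%N := leq_trans (ltn_ord j) ki.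
  have [-> _ _] := h0 j i.
  have [_ _] := h0 i j.
  by rewrite (word_formC pauli_comm_sym) => ->; rewrite gtn_eqF // !mulr0 addr0.
have wq k i : word_form pauli_comm (w k) (q0 i) = f k i.
  have [ki|ik] := leqP (n k) i; last first.
    by rewrite (word_comb_q _ _ (@pauli_comm_hyperbolic _) ik).
  rewrite fn // word_comb_form big1 // => j _.
  have lt_ji : (j < i)%N := leq_trans (ltn_ord j) ki.
  have [_ -> ->] := h0 j i.
  by rewrite ltn_eqF // !mulr0 addr0.
have wform k l : word_form pauli_comm (w k) (w l) = c k l.
  rewrite -word_form1 form_n !word_comb_form; apply: eq_bigr => i _.
  rewrite ![word_form pauli_comm _ (w l)](word_formC pauli_comm_sym) wp wq.
  by rewrite ![word_form c _ [:: l]](word_formC c_sym).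
have sU : spin_system c (fun k => herm_wordop pauli_comm S (w k)).
  split=> [|k|k|k l x]; first by exists (e 0%N).
  - exact: (herm_wordop_sa pauli_comm_sym).
  - apply: (@adjoint_unitary _ _ _ _ (herm_wordop pauli_comm S (w k)));
      try exact: herm_wordop_linear.
    + exact: (herm_wordop_sa pauli_comm_sym).
    + exact: (herm_wordopK pauli_comm_sym).
    + exact: (herm_wordopK pauli_comm_sym).
  - by rewrite (herm_wordop_comm pauli_comm_sym sS) wform.
exists (fun k => herm_wordop pauli_comm S (w k)); split=> //.
apply/seteqP; split=> [T [bT cT]|_ [a _ <-]]; last first.
  split.
    split; last exact: scaler_continuous.
    by move=> b x y; rewrite scalerDr !scalerA mulrC.
  move=> _ [k _ <-]; apply/funext => x /=.
  by rewrite (linmapZ (herm_wordop_linear sS _)).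
pose W x := flatten [seq w k | k <- x].
(* [T] is known to commute with the words multiplied by nonzero phases, which cancel. *)
have TW x y : T (wordop S (W x) y) = wordop S (W x) (T y).
  elim: x => //= k x IHx in y *; rewrite /W /= !wordop_cat -/(W x) -IHx.
  apply: (scalerI (word_phase_neq0 pauli_comm (w k))); rewrite -(linmapZ bT.1).
  have := cT _ (ex_intro2 _ _ k I erefl).
  by move=> /(congr1 (fun F => F (wordop S (W x) y))).
have W_even x j : word_vec (W x) j.*2 = word_form c x (q j).
  elim: x => [|k x IHx]; first by rewrite word_form_nill /W /= word_vec_nil.
  rewrite /W /= -/(W x) word_vec_cat word_form_consl -IHx.
  rewrite -[LHS]/(word_vec (w k) j.*2 + word_vec (W x) j.*2).
  by rewrite word_comb_vec_even -[word_form c [:: k] _]/(f k j); case: ltnP => [//|/fn->].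
have W_odd x j : word_vec (W x) j.*2.+1 = word_form c x (p j).
  elim: x => [|k x IHx]; first by rewrite word_form_nill /W /= word_vec_nil.
  rewrite /W /= -/(W x) word_vec_cat word_form_consl -IHx.
  rewrite -[LHS]/(word_vec (w k) j.*2.+1 + word_vec (W x) j.*2.+1).
  by rewrite word_comb_vec_odd -[word_form c [:: k] _]/(g k j); case: ltnP => [//|/gn->].
have comm1 x m : word_vec (W x) = word_vec [:: m] ->
    forall y, T (S m y) = S m (T y).
  move=> xm; have [a aP] := wordop_parity pauli_comm_sym R
    (fun k => word_vec_odd k xm).
  move=> y; have := TW x y; rewrite !(aP _ _ sS) /= (linmapZ bT.1).
  exact: (scalerI (sign2_neq0 a)).
have vec_ext u v : (forall j, word_vec u j.*2 = word_vec v j.*2) ->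
    (forall j, word_vec u j.*2.+1 = word_vec v j.*2.+1) -> word_vec u = word_vec v.
  move=> ev od; apply/funext => m; rewrite -(odd_double_half m).
  by case: (odd m); [exact: od|exact: ev].
have vec1 m j : word_vec [:: m] j = (m == j)%:R by rewrite /word_vec /= addn0.
have odd_even i j : (i.*2.+1 == j.*2) = false.
  by apply/eqP => /(congr1 odd); rewrite /= !odd_double.
have [k x|a aP] := pauli_gen_commutant be e0 bT; last first.
  by exists a => //; apply/funext => x; rewrite aP.
(* The model generator of index [2j + 1] comes from [q j], that of index [2j] from [p j]. *)
rewrite -(odd_double_half k); case: (odd k) => /=.
  apply: (comm1 (q k./2)); apply: vec_ext => j; rewrite vec1.
    by rewrite W_even odd_even; have [_ -> _] := h k./2 j.
  rewrite W_odd eqSS (inj_eq double_inj) (word_formC c_sym).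
  by have [_ _ ->] := h j k./2; rewrite eq_sym.
apply: (comm1 (p k./2)); apply: vec_ext => j; rewrite vec1.
  by rewrite W_even (inj_eq double_inj); have [_ _ ->] := h k./2 j.
by rewrite W_odd eq_sym odd_even; have [-> _ _] := h k./2 j.
Qed.

End Existence.

Section L2Basis.
Variable R : realType.
Local Notation C := R[i].

Definition delta_fun (n k : nat) : C := (k == n)%:R.

Lemma delta_square_summable n : delta_fun n \in @square_summable R.
Proof.
apply/asboolP; exists 1 => K; rewrite /sqsum /delta_fun.
have E k : sqmod ((k == n)%:R : C) = (k == n)%:R.
  by rewrite /sqmod; case: eqP => _ /=; rewrite ?expr1n expr0n /= ?addr0.
under eq_bigr => k _ do rewrite E.
have [nK|Kn] := ltnP n K.
  rewrite (bigD1_seq n) ?mem_index_iota ?iota_uniq //= eqxx big1 ?addr0 //.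
  by move=> i /negPf ->.
rewrite big1_seq ?ler01 // => k /andP[_]; rewrite mem_index_iota => /andP[_ kK].
by rewrite ltn_eqF // (leq_trans kK).
Qed.

Definition l2_delta (n : nat) : l2 R := L2 (delta_square_summable n).

Lemma l2_inner_delta (f : l2 R) n : inner f (l2_delta n) = f n.
Proof.
rewrite -[LHS]/(csum (fun k => f k * (delta_fun n k)^*)).
have E k : f k * (delta_fun n k)^* = (k == n)%:R * f k.
  by rewrite /delta_fun rmorph_nat mulrC.
rewrite (funext E).
have lim1 (u : nat -> R) : limn (series (fun k => (k == n)%:R * u k)) = u n.
  apply: cvg_lim => //; apply: cvg_near_cst; exists n.+1 => // m /= nm.
  rewrite /series /= (bigD1_seq n) ?mem_index_iota ?iota_uniq //= eqxx mul1r.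
  by rewrite big1 ?addr0 // => i /negPf ->; rewrite mul0r.
have ReE k : complex.Re ((k == n)%:R * f k) = (k == n)%:R * complex.Re (f k).
  by case: eqP => _; rewrite ?mul1r ?mul0r.
have ImE k : complex.Im ((k == n)%:R * f k) = (k == n)%:R * complex.Im (f k).
  by case: eqP => _; rewrite ?mul1r ?mul0r.
rewrite /csum (funext ReE) (funext ImE) !lim1.
by case: (f n).
Qed.

Lemma l2_orthobasis : orthobasis l2_delta /\ forall i, l2_delta i != 0.
Proof.
have d1 i : inner (l2_delta i) (l2_delta i) = 1.
  by rewrite l2_inner_delta /= /delta_fun eqxx.
have d0 i : l2_delta i != 0.
  apply/eqP => d; have := d1 i; rewrite d inner0l => /esym/eqP.
  by rewrite oner_eq0.
split=> //; split=> [|f f0].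
  split=> [i j ij|i]; last by rewrite d1 d0.
  by rewrite l2_inner_delta /= /delta_fun eq_sym (negPf ij).
by apply/val_inj/funext => k /=; rewrite -l2_inner_delta f0.
Qed.

End L2Basis.

(** * Counting the classes *)

Section PairingLinear.

Lemma F2_scaleE (a : 'F_2) (x : Z2infty) : a *: x = if a == 0 then 0 else x.
Proof. by case: (F2P a) => ->; rewrite ?scale0r ?scale1r. Qed.

Lemma Gamma0 : Gamma 0.
Proof. by rewrite -word_vec_nil; exact: word_vec_Gamma. Qed.

Lemma pairing0 gamma : pairing gamma 0 = 0.
Proof. by rewrite -word_vec_nil pairing_word_vec big_nil. Qed.

Lemma pairing_comb gamma d (b : 'I_d -> Z2infty) (a : 'I_d -> 'F_2) :
  (forall i, Gamma (b i)) ->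
  pairing gamma (\sum_i a i *: b i) = \sum_i a i * pairing gamma (b i).
Proof.
move=> Gb.
suff [] : Gamma (\sum_i a i *: b i) /\
  pairing gamma (\sum_i a i *: b i) = \sum_i a i * pairing gamma (b i) by [].
apply: (big_ind2 (fun x y => Gamma x /\ pairing gamma x = y)).
- by split; [exact: Gamma0|exact: pairing0].
- by move=> x u y v [Gx <-] [Gy <-]; split; [exact: GammaD|exact: pairingD].
move=> i _; rewrite F2_scaleE; case: (F2P (a i)) => ->.
  by rewrite eqxx mul0r; split; [exact: Gamma0|exact: pairing0].
by rewrite oner_eq0 mul1r; split.
Qed.

End PairingLinear.

Section PivotDimension.
Variable N : set Z2infty.
Hypothesis N_Gamma : N `<=` Gamma.
Hypothesis ND : forall x y, N x -> N y -> N (x + y).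

Let N_below n : set Z2infty := [set x | N x /\ below n x].

(** Passing from [n] to [n + 1] adds one basis vector if [n] is a pivot and changes nothing
    otherwise. *)
Lemma below_dim n : exists d, quotient_dim (N_below n) [set 0] d.
Proof.
have F2N (x : Z2infty) : - x = x by apply/funext => k; exact: F2_oppr.
have F2x (x : Z2infty) : x + x = 0 by rewrite -{1}[x]F2N addNr.
elim: n => [|n [d [b [bN bP]]]].
  exists 0%N, (fun=> 0); split=> [[]//|x [Nx x0]].
  exists [ffun=> 0]; split=> [|a _]; last by apply/ffunP => -[].
  by rewrite big_ord0 subr0; apply/funext => k; exact: x0.
have [[z Nz [zn nz]]|np] := pselect (pivot N n); last first.
  have NS x : N_below n.+1 x -> N_below n x.
    move=> [Nx xn]; split=> // k; rewrite leq_eqVlt => /orP[/eqP<-|]; last exact: xn.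
    have [//|xn1] := F2P (x n).
    by exfalso; apply: np; exists x.
  exists d, b; split=> [i|x /NS/bP//]; have [Nb bn] := bN i.
  by split=> // k /ltnW; exact: bn.
pose b' (i : 'I_d.+1) := oapp b z (unlift ord0 i).
have sumE (a : {ffun 'I_d.+1 -> 'F_2}) :
    \sum_i a i *: b' i = a ord0 *: z + \sum_i a (lift ord0 i) *: b i.
  rewrite big_ord_recl /b' unlift_none /=; congr (_ + _).
  by apply: eq_bigr => i _; rewrite liftK.
exists d.+1, b'; split=> [i|x [Nx xn]].
  rewrite /b'; case: unliftP => [j _|_] /=; last by split.
  by have [Nb bn] := bN j; split=> // k /ltnW; exact: bn.
pose y := x + x n *: z.
have yE : N_below n y.
  rewrite /y; case: (F2P (x n)) => xn1; rewrite xn1 ?scale0r ?scale1r ?addr0.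
    by split=> // k; rewrite leq_eqVlt => /orP[/eqP<-//|]; exact: xn.
  split; first exact: ND.
  move=> k; rewrite leq_eqVlt => /orP[/eqP<-|nk].
    by rewrite -[LHS]/(x n + z n) xn1 zn F2_addrr.
  by rewrite -[LHS]/(x k + z k) xn // nz // addr0.
have [a [aP aU]] := bP y yE.
exists [ffun i => oapp a (x n) (unlift ord0 i)]; split=> [|a' a'P].
  rewrite sumE ffunE unlift_none /=.
  under eq_bigr => i _ do rewrite ffunE liftK /=.
  by rewrite opprD addrA F2N.
(* Among the basis vectors only [z] is nonzero at [n], so its coefficient is read off there. *)
have a'0 : a' ord0 = x n.
  have : x = \sum_i a' i *: b' i by apply/eqP; rewrite -subr_eq0; apply/eqP.
  rewrite sumE => /(congr1 (fun u : Z2infty => u n)).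
  have -> : (a' ord0 *: z + \sum_i a' (lift ord0 i) *: b i) n =
      a' ord0 * z n + (\sum_i a' (lift ord0 i) *: b i) n by [].
  have -> : (\sum_i a' (lift ord0 i) *: b i) n = 0.
    apply: (big_ind (fun u : Z2infty => u n = 0)) => // [u v u0 v0|i _].
      by rewrite -[LHS]/(u n + v n) u0 v0 addr0.
    have [_ bn] := bN i.
    by rewrite -[LHS]/(a' (lift ord0 i) * b i n) bn ?mulr0.
  by rewrite zn mulr1 addr0.
have aE : a = [ffun i => a' (lift ord0 i)].
  apply: aU; under eq_bigr => i _ do rewrite ffunE.
  by move: a'P; rewrite sumE a'0 opprD addrA F2N.
apply/ffunP => i; rewrite ffunE; case: unliftP => [j ->|->] /=.
  by rewrite aE ffunE.
by rewrite a'0.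
Qed.

(** The last nonzero coordinate of an element of [N] is a pivot; if pivots were bounded by [n], all
    of [N] would lie below [n] and have finite dimension. *)
Lemma infinite_pivots : infinite_dim N ->
  forall n, exists2 j, (n <= j)%N & pivot N j.
Proof.
move=> Ninf n; apply: contrapT => np.
have Nn x : N x -> below n x.
  move=> Nx; have [m] := Gamma_below (N_Gamma Nx).
  elim: m => [|m IHm] xm; first by move=> k _; exact: xm.
  have [lt_mn|nm] := ltnP m n; first by move=> k nk; apply: xm; exact: leq_trans nk.
  apply: IHm => k; rewrite leq_eqVlt => /orP[/eqP<-|]; last exact: xm.
  have [//|xm1] := F2P (x m).
  by exfalso; apply: np; exists m => //; exists x.
have [d [b [bN bP]]] := below_dim n; apply: (Ninf d); exists b.
split=> [i|x Nx]; first by case: (bN i).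
by apply: bP; split=> //; exact: Nn.
Qed.

End PivotDimension.

Section Counting.
Context {R : realType}.
Local Notation C := R[i].
Variable c : nat -> nat -> 'F_2.
Hypothesis c_sym : forall i j, c i j = c j i.
Hypothesis c_diag : forall i, c i i = 0.
Hypothesis c_rank : infinite_rank c.

Lemma spin_equivP (H K : hilbertType R) (U : nat -> H -> H) (V : nat -> K -> K) :
  irreducible_spin_system c U -> irreducible_spin_system c V ->
  spin_equiv U V <-> same_scalars c U V.
Proof.
move=> iU iV; split; first exact: equiv_same_scalars.
exact: same_scalars_equiv.
Qed.

Lemma same_scalars_sym (H K : hilbertType R) (U : nat -> H -> H) (V : nat -> K -> K) :
  irreducible_spin_system c U -> irreducible_spin_system c V ->
  same_scalars c U V -> same_scalars c V U.
Proof.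
move=> iU iV UV w kw b bP x; have [a aP] := irreducible_ker c_sym iU kw.
have [[v v0] _ _ _] := iV.1.
suff -> : b = a by [].
apply/eqP; rewrite -subr_eq0 -[_ == 0]orbF -(negPf v0) -scaler_eq0 scalerBl.
by rewrite -bP (UV w kw a aP) subrr.
Qed.

Lemma same_scalars_trans (H K L : hilbertType R) (U : nat -> H -> H)
    (V : nat -> K -> K) (S : nat -> L -> L) :
  same_scalars c U V -> same_scalars c V S -> same_scalars c U S.
Proof. by move=> UV VS w kw a aP; apply: (VS w kw); exact: UV. Qed.

(** That [spin_equiv] is an equivalence relation is read off [same_scalars], so no sequences of
    unitaries are inverted or composed. *)
Lemma spin_class_eqP (S T : irrSpinSystem R c) :
  spin_class S = spin_class T <-> spin_equiv (@spin_op _ _ S) (@spin_op _ _ T).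
Proof.
have [iS iT] := (spin_opP S, spin_opP T).
split=> [ST|/(spin_equivP iS iT) ST].
  change (spin_class S T); rewrite ST; apply/(spin_equivP iT iT).
  by move=> w kw a.
apply/funext => X; apply/propext; have iX := spin_opP X.
split=> /spin_equivP h; apply/spin_equivP => //.
  by apply: same_scalars_trans (h iS iX); exact: same_scalars_sym.
by apply: same_scalars_trans ST _; exact: h.
Qed.

Section Classes.
Variables (H : hilbertType R) (U : nat -> H -> H).
Hypothesis iU : irreducible_spin_system c U.

Definition twist_class (gamma : Z2infty) : irrSpinSystem R c -> Prop :=
  spin_class (IrrSpinSystem (twist_irreducible gamma iU)).

Lemma twist_class_eqP gamma gamma' :
  twist_class gamma = twist_class gamma' <->
  (forall x, ker_omega c x -> pairing gamma x = pairing gamma' x).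
Proof.
rewrite -(twist_equivP c_sym c_diag c_rank gamma gamma' iU).
exact: spin_class_eqP.
Qed.

Lemma spin_class_twist A : is_spin_class A ->
  exists2 gamma : Z2infty,
    (forall j, ~ pivot (ker_omega c) j -> gamma j = 0) & A = twist_class gamma.
Proof.
move=> [S ->].
have [gamma g0 e] := twist_representative c_sym c_diag c_rank iU (spin_opP S).
by exists gamma => //; apply/spin_class_eqP.
Qed.

(** A class amounts to a functional on the radical, hence to its values on the [d] basis vectors;
    [ga] realizes every choice of values by a twist. *)
Lemma finite_classes d : has_dim (ker_omega c) d -> spin_classes_card R c 'I_(2 ^ d).
Proof.
move=> [b [bk bP]].
have kG : ker_omega c `<=` Gamma by move=> x [].
pose ffT : finType := {ffun 'I_d -> 'F_2}.
have card_ff : #|ffT| = (2 ^ d)%N by rewrite card_ffun !card_ord.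
have [co coP] : {co : Z2infty -> ffT & forall x, ker_omega c x ->
    x = \sum_i co x i *: b i /\
    forall a : ffT, x = \sum_i a i *: b i -> co x = a}.
  apply: (@choice _ _ (fun (x : Z2infty) (co : ffT) => ker_omega c x ->
    x = \sum_i co i *: b i /\
    forall a : ffT, x = \sum_i a i *: b i -> co = a)) => x.
  have [kx|nk] := pselect (ker_omega c x); last by exists [ffun=> 0].
  have [a [aP aU]] := bP x kx; exists a => _; split.
    by apply/eqP; rewrite -subr_eq0; apply/eqP.
  by move=> a' xa'; apply: aU; rewrite /= -xa' subrr.
have coD x y : ker_omega c x -> ker_omega c y ->
    co (x + y) = [ffun i => co x i + co y i].
  move=> kx ky; have [_ xyU] := coP _ (ker_omegaD c_sym kx ky).
  apply: xyU; under eq_bigr => i _ do rewrite ffunE scalerDl.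
  by rewrite big_split -(coP x kx).1 -(coP y ky).1.
have [ga gaP] : {ga : ffT -> Z2infty & forall a x, ker_omega c x ->
    pairing (ga a) x = \sum_i co x i * a i}.
  apply: (@choice _ _ (fun (a : ffT) (g : Z2infty) => forall x, ker_omega c x ->
    pairing g x = \sum_i co x i * a i)) => a.
  have [|g _ gP] := @pivot_extension (ker_omega c) kG (ker_omegaD c_sym)
    (fun x => \sum_i co x i * a i).
    move=> x y kx ky; rewrite coD // -big_split; apply: eq_bigr => i _.
    by rewrite ffunE mulrDl.
  by exists g.
have cob i : co (b i) = [ffun j => (j == i)%:R].
  apply: (coP _ (bk i)).2; rewrite (bigD1 i) //= ffunE eqxx scale1r.
  by rewrite big1 ?addr0 // => j /negPf ji; rewrite ffunE ji scale0r.
have gab a i : pairing (ga a) (b i) = a i.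
  rewrite gaP // cob (bigD1 i) //= ffunE eqxx mul1r.
  by rewrite big1 ?addr0 // => j /negPf ji; rewrite ffunE ji mul0r.
pose en (i : 'I_(2 ^ d)) : ffT := enum_val (cast_ord (esym card_ff) i).
exists (fun i => twist_class (ga (en i))); split=> [i j /twist_class_eqP h|A].
  have /enum_val_inj/cast_ord_inj : en i = en j; last by [].
  by apply/ffunP => k; rewrite -!gab; exact: h.
split=> [/spin_class_twist[gamma _ ->]|[i <-]]; last by eexists.
pose a : ffT := [ffun i => pairing gamma (b i)].
exists (cast_ord card_ff (enum_rank a)); rewrite /en cast_ordK enum_rankK.
apply/twist_class_eqP => x kx; rewrite [x](coP x kx).1.
have Gb i : Gamma (b i) by have [] := bk i.
by rewrite !pairing_comb //; apply: eq_bigr => i _; rewrite gab ffunE.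
Qed.

(** Sequences supported on the pivots represent each class exactly once, and [phi] numbers the
    infinitely many pivots. *)
Lemma infinite_classes : infinite_dim (ker_omega c) ->
  spin_classes_card R c (nat -> bool).
Proof.
move=> kinf.
have kG : ker_omega c `<=` Gamma by move=> x [].
have pinf := infinite_pivots kG (ker_omegaD c_sym) kinf.
have [|phi [phi_inj phi_pivot phi_surj]] :=
    @infinite_enum (fun j => `[< pivot (ker_omega c) j >]).
  by move=> n; have [j nj pj] := pinf n; exists j => //; apply/asboolP.
pose ga (s : nat -> bool) : Z2infty :=
  fun j => (`[< exists2 k, phi k = j & s k >])%:R.
have gaE s k : ga s (phi k) = (s k)%:R.
  rewrite /ga; congr (_%:R); congr nat_of_bool.
  apply/asboolP/idP => [[l /phi_inj->//]|sk].
  by exists k.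
have ga0 s j : ~ pivot (ker_omega c) j -> ga s j = 0.
  move=> nj; rewrite /ga asboolF // => -[k kj _]; apply: nj.
  by rewrite -kj; apply/asboolP; exact: phi_pivot.
exists (fun s => twist_class (ga s)); split=> [s s' /twist_class_eqP h|A].
  apply/funext => k.
  have : ga s (phi k) = ga s' (phi k).
    by rewrite (pivot_unique (ga0 s) (ga0 s') h).
  by rewrite !gaE; case: (s k); case: (s' k).
split=> [/spin_class_twist[gamma g0 ->]|[s <-]]; last by eexists.
exists (fun k => gamma (phi k) == 1); congr twist_class; apply/funext => j.
have [/asboolP/phi_surj[k <-]|nj] := pselect (pivot (ker_omega c) j).
  by rewrite gaE; case: (F2P (gamma (phi k))) => ->.
by rewrite ga0 // g0.
Qed.

End Classes.
End Counting.

Theorem theoremC (R : realType) (c : nat -> nat -> 'F_2)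
    (c_sym : forall i j, c i j = c j i)
    (c_diag : forall i, c i i = 0)
    (c_rank : infinite_rank c) :
  (forall (H : hilbertType R) (U : nat -> H -> H),
     irreducible_spin_system c U ->
     (forall (K : hilbertType R) (V : nat -> K -> K),
        irreducible_spin_system c V ->
        exists gamma : Z2infty, spin_equiv V (twist gamma U)) /\
     (forall gamma gamma' : Z2infty,
        spin_equiv (twist gamma U) (twist gamma' U) <->
        (forall x, ker_omega c x -> pairing gamma x = pairing gamma' x))) /\
  (forall d : nat, has_dim (ker_omega c) d ->
     spin_classes_card R c 'I_(2 ^ d)) /\
  (infinite_dim (ker_omega c) ->
     spin_classes_card R c (nat -> bool)).
Proof.
have [l2b l2n0] := l2_orthobasis R.
(* The counts take [U0] as base point: every class is that of one of its twists. *)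
have [U0 iU0] := irreducible_of_basis c_sym c_diag c_rank l2b l2n0.
split=> [H U iU|].
  split=> [K V iV|gamma gamma']; last exact: (twist_equivP c_sym c_diag c_rank).
  have [gamma _ e] := twist_representative c_sym c_diag c_rank iU iV.
  by exists gamma.
split=> [d|]; first exact: (finite_classes c_sym c_diag c_rank iU0).
exact: (infinite_classes c_sym c_diag c_rank iU0).
Qed.
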